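(* Let $A$ be a finite dimensional algebra over a field $k$. Then the $\nu$-dominant dimension of $A$ is at least $2$ if and only if $A$ is a Morita algebra.
   Context: $k$ is an arbitrary field; algebras are finite dimensional $k$-algebras and modules are finitely generated left modules. Let $\mathrm{D}=\mathrm{Hom}_k(-,k)$ and let $\nu_A=\mathrm{D}\mathrm{Hom}_A(-,A)$ be the Nakayama functor. A projective $A$-module $P$ is strongly projective-injective if $\nu_A^i(P)$ is projective for all $i>0$. The $\nu$-dominant dimension of $A$ is the largest $d\ge 0$ (or $\infty$) such that in a minimal injective resolution $0\to {}_AA\to I^0\to I^1\to\cdots$ the module $I^i$ is strongly projective-injective for all $i<d$. $A$ is a Morita algebra if $A$ is isomorphic to $\mathrm{End}_H(H\oplus M)$ for some self-injective algebra $H$ and some finitely generated $H$-module $M$. *)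

(* Defs.v *)
From HB Require Import structures.
From mathcomp Require Import all_boot all_order all_algebra all_field.

Set Implicit Arguments.
Unset Strict Implicit.
Unset Printing Implicit Defensive.

Import GRing.Theory.
Local Open Scope ring_scope.

(* Over a finite dimensional k-algebra A, a finitely generated left A-module  *)
(* is a finite dimensional k-space with a unital k-linear action of A: the    *)
(* scalar action of k is the restriction of the action of A along c |-> c%:A, *)
(* and M is finitely generated over A iff it is finite dimensional over k.    *)
Record amod (k : fieldType) (A : falgType k) := AMod {
  amod_space :> vectType k;
  act : A -> amod_space -> amod_space;
  act_linear_l : forall v, linear (fun a => act a v);
  act_linear_r : forall a, linear (act a);
  act1 : forall v, act 1 v = v;
  actM : forall a b v, act (a * b) v = act a (act b v)
}.
Arguments act {k A} M a v : rename.

Section LinFun.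
Variables (k : fieldType) (U V : vectType k).

Lemma linfunE (f : U -> V) : linear f -> linfun f =1 f.
Proof.
move=> fL x.
pose L := GRing.isLinear.Build k U V *:%R f fL.
pose F : {linear U -> V} := HB.pack f L.
exact: (lfunE F).
Qed.

End LinFun.

Section Modules.
Variables (k : fieldType) (A : falgType k).
Implicit Types (M N P Q : amod A).

Definition is_hom M N (f : 'Hom(M, N)) : Prop :=
  forall (a : A) (v : M), f (act M a v) = act N a (f v).

Definition submodule M (U : {vspace M}) : Prop :=
  forall (a : A) (v : M), v \in U -> act M a v \in U.

Definition projective_mod P : Prop :=
  forall M N (g : 'Hom(M, N)) (f : 'Hom(P, N)),
    is_hom g -> limg g = fullv -> is_hom f ->
    exists h : 'Hom(P, M), is_hom h /\ (g \o h)%VF = f.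

Definition injective_mod Q : Prop :=
  forall M N (g : 'Hom(M, N)) (f : 'Hom(M, Q)),
    is_hom g -> lker g = 0%VS -> is_hom f ->
    exists h : 'Hom(N, Q), is_hom h /\ (h \o g)%VF = f.

Definition essential M (U : {vspace M}) : Prop :=
  forall V : {vspace M}, submodule V -> (U :&: V)%VS = 0%VS -> V = 0%VS.

Fact regular_linear_l (v : A) : linear (fun a => a * v).
Proof. by move=> c a b; rewrite mulrDl scalerAl. Qed.

Fact regular_linear_r (a : A) : linear ( *%R a).
Proof. by move=> c u v; rewrite mulrDr scalerAr. Qed.

Definition regular : amod A :=
  AMod regular_linear_l regular_linear_r (@mul1r A)
    (fun a b v => esym (mulrA a b v)).

Definition act_end M (a : A) : 'End(M) := linfun (act M a).

Lemma act_endE M a v : act_end M a v = act M a v.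
Proof. by rewrite linfunE //; apply: act_linear_r. Qed.

Section HomSpace.
Variables M N : amod A.

Definition hom_defect (a : A) (f : 'Hom(M, N)) : 'Hom(M, N) :=
  ((f \o act_end M a) - (act_end N a \o f))%VF.

Fact hom_defect_linear a : linear (hom_defect a).
Proof.
move=> c f g; rewrite /hom_defect comp_lfunDl comp_lfunDr -comp_lfunZl.
by rewrite -comp_lfunZr scalerBr opprD addrACA.
Qed.

(* Hom_A(M, N), as the k-subspace of 'Hom(M, N) of the maps commuting with    *)
(* the action of a k-basis of A; see homAP.                                   *)
Definition homA : {vspace 'Hom(M, N)} :=
  (\bigcap_(i < \dim {:A}) lker (linfun (hom_defect (vbasis {:A})`_i)))%VS.

Lemma homAP f : reflect (is_hom f) (f \in homA).
Proof.
rewrite memvE; apply: (iffP subv_bigcapP) => [f0 a v | fhom i _].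
  rewrite -(linfunE (act_linear_l v)) -(linfunE (act_linear_l (f v))).
  rewrite (coord_vbasis (memvf a)) !linear_sum; apply: eq_bigr => i _.
  rewrite !linearZ /=; congr (_ *: _).
  rewrite (linfunE (act_linear_l v)) (linfunE (act_linear_l (f v))).
  have := f0 i isT; rewrite -memvE memv_ker linfunE; last first.
    exact: hom_defect_linear.
  move=> /eqP/lfunP/(_ v); rewrite !lfunE /= !lfunE /= !lfunE /= !act_endE.
  by move/eqP; rewrite subr_eq0 => /eqP.
rewrite -memvE memv_ker linfunE; last exact: hom_defect_linear.
apply/eqP/lfunP=> v; rewrite !lfunE /= !lfunE /= !lfunE /= !act_endE.
by rewrite fhom subrr.
Qed.

End HomSpace.

Section Nakayama.
Variable M : amod A.

Let HomMA := subvs_of (homA M regular).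
Let D := 'Hom(HomMA, k^o).

(* The right A-module structure (phi . a)(m) = phi(m) * a of Hom_A(M, A).     *)
Definition hom_mulr (a : A) (phi : HomMA) : HomMA :=
  vsproj (homA M regular) (amulr a \o vsval phi)%VF.

Lemma hom_mulrE a phi m : vsval (hom_mulr a phi) m = vsval phi m * a.
Proof.
rewrite vsprojK ?comp_lfunE ?lfunE //; apply/homAP=> b v.
by rewrite !comp_lfunE (homAP _ (subvsP phi)) !lfunE /= mulrA.
Qed.

Fact hom_mulr_linear a : linear (hom_mulr a).
Proof.
move=> c f g; apply/val_inj/lfunP=> m /=.
rewrite add_lfunE scale_lfunE !hom_mulrE /= add_lfunE scale_lfunE mulrDl.
by congr (_ + _); rewrite [RHS](@scalerAl k A).
Qed.

(* D Hom_A(M, A) is a left A-module via (a . F)(phi) = F(phi . a).            *)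
Definition nakayama_act (a : A) (F : D) : D := (F \o linfun (hom_mulr a))%VF.

Lemma nakayama_actE a F phi : nakayama_act a F phi = F (hom_mulr a phi).
Proof. by rewrite comp_lfunE linfunE //; apply: hom_mulr_linear. Qed.

Fact nakayama_linear_l F : linear (fun a => nakayama_act a F).
Proof.
move=> c a b; apply/lfunP=> phi.
rewrite add_lfunE scale_lfunE !nakayama_actE -linearP; congr (F _).
apply/val_inj/lfunP=> m /=.
rewrite add_lfunE scale_lfunE !hom_mulrE mulrDr.
by congr (_ + _); rewrite [RHS](@scalerAr k A).
Qed.

Fact nakayama_linear_r a : linear (nakayama_act a).
Proof.
by move=> c F G; rewrite /nakayama_act comp_lfunDl comp_lfunZl.
Qed.

Fact nakayama_act1 F : nakayama_act 1 F = F.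
Proof.
apply/lfunP=> phi; rewrite nakayama_actE; congr (F _).
by apply/val_inj/lfunP=> m /=; rewrite hom_mulrE mulr1.
Qed.

Fact nakayama_actM a b F :
  nakayama_act (a * b) F = nakayama_act a (nakayama_act b F).
Proof.
apply/lfunP=> phi; rewrite !nakayama_actE; congr (F _).
by apply/val_inj/lfunP=> m /=; rewrite !hom_mulrE mulrA.
Qed.

Definition nakayama : amod A :=
  AMod nakayama_linear_l nakayama_linear_r nakayama_act1 nakayama_actM.

End Nakayama.

Definition strongly_projinj P : Prop :=
  projective_mod P /\ forall i : nat, (0 < i)%N ->
    projective_mod (iter i nakayama P).

(* 0 -> M -eps-> I 0 -d 0-> I 1 -d 1-> ... is an injective resolution.        *)
Definition injective_resolution M (I : nat -> amod A)
    (eps : 'Hom(M, I 0)) (d : forall n, 'Hom(I n, I n.+1)) : Prop :=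
  [/\ forall n, injective_mod (I n),
      is_hom eps /\ (forall n, is_hom (d n)),
      lker eps = 0%VS,
      limg eps = lker (d 0)
    & forall n, limg (d n) = lker (d n.+1)].

(* Minimality: each term is an injective envelope of the image of the map     *)
(* into it.                                                                   *)
Definition minimal_injective_resolution M (I : nat -> amod A)
    (eps : 'Hom(M, I 0)) (d : forall n, 'Hom(I n, I n.+1)) : Prop :=
  [/\ injective_resolution eps d,
      essential (limg eps)
    & forall n, essential (limg (d n))].

Definition strongly_projinj_below (I : nat -> amod A) (n : nat) : Prop :=
  forall i, (i < n)%N -> strongly_projinj (I i).

(* The values in {0, 1, ..., oo} are encoded by option nat, with None for oo. *)
Definition is_nu_domdim (d : option nat) : Prop :=
  exists (I : nat -> amod A) (eps : 'Hom(regular, I 0))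
         (delta : forall n, 'Hom(I n, I n.+1)),
    minimal_injective_resolution eps delta /\
    match d with
    | Some n => strongly_projinj_below I n /\
                forall m, strongly_projinj_below I m -> (m <= n)%N
    | None => forall m, strongly_projinj_below I m
    end.

Definition nu_domdim_ge (n : nat) : Prop :=
  exists d, is_nu_domdim d /\ (if d is Some m then (n <= m)%N else true).

Definition self_injective : Prop := injective_mod regular.

Section DirectSum.
Variables M N : amod A.

Let dsum_act (a : A) (v : (M * N)%type) : (M * N)%type :=
  (act M a v.1, act N a v.2).

Fact dsum_linear_l v : linear (fun a => dsum_act a v).
Proof. by move=> c a b; congr pair; rewrite /= act_linear_l. Qed.

Fact dsum_linear_r a : linear (dsum_act a).
Proof. by move=> c u v; congr pair; rewrite /= act_linear_r. Qed.

Fact dsum_act1 v : dsum_act 1 v = v.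
Proof. by case: v => u v; rewrite /dsum_act !act1. Qed.

Fact dsum_actM a b v : dsum_act (a * b) v = dsum_act a (dsum_act b v).
Proof. by rewrite /dsum_act !actM. Qed.

Definition dsum : amod A :=
  AMod dsum_linear_l dsum_linear_r dsum_act1 dsum_actM.

End DirectSum.
End Modules.

(* B is isomorphic, as a k-algebra, to End_A(M) = homA M M, with composition  *)
(* as product. MathComp has no canonical ring structure on 'End(V), hence the *)
(* explicit multiplicativity conditions.                                      *)
Definition isom_End (k : fieldType) (B A : falgType k) (M : amod A) : Prop :=
  exists phi : 'Hom(B, 'End(M)),
    [/\ lker phi = 0%VS, limg phi = homA M M, phi 1 = \1%VF
      & forall a b, phi (a * b) = (phi a \o phi b)%VF].

Definition Morita_algebra (k : fieldType) (A : falgType k) : Prop :=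
  exists (H : falgType k) (M : amod H),
    self_injective H /\ isom_End A (dsum (regular H) M).

(* Main.v *)
(* For "only if", take an idempotent e such that Ae is strongly projective and *)
(* injective, of maximal dimension; by maximality every such module lies in    *)
(* add(Ae), in particular I^0, I^1 and nu(Ae) = D(eA).  Hence D(eAe) is        *)
(* projective, that is, H = (eAe)^op = End_A(Ae) is self-injective, and A is   *)
(* the double centralizer End_H(Ae), where Ae = eAe + (1-e)Ae as H-modules.    *)
(*                                                                             *)
(* For "if", let A = End_H(G) with G = H + M.  As an A-module, G is            *)
(* projective, and nu_A(G) = D Hom_H(G, H) lies in add(D Hom_H(G, DH)) =       *)
(* add(G) because H lies in add(DH); so G is strongly projective.  The chain   *)
(* add(nu^i G) decreases, so it is eventually stationary, and since nu is      *)
(* fully faithful on projectives G lies in add(nu G); hence G is injective.    *)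
(* Finally A is the kernel of End_k(G) -> Hom_k(H, End_k(G)), f |-> [f, -],    *)
(* a map between modules in add(G), whence the first two terms of a minimal    *)
(* injective resolution of A are in add(G).                                    *)

From HB Require Import structures.
From Stdlib Require Classical_Prop Classical_Pred_Type IndefiniteDescription.
Require Import Defs.
From mathcomp Require Import all_boot all_order all_algebra all_field.

Set Implicit Arguments.
Unset Strict Implicit.
Unset Printing Implicit Defensive.

Import GRing.Theory.
Local Open Scope ring_scope.

(** Both directions rest on a module G that is strongly projective and injective, and on an exact
    sequence 0 -> A -> Q0 -> Q1 with Q0, Q1 in add(G). Given such a sequence, A acts faithfully on
    G, and every linear endomorphism of G commuting with End_A(G) is the action of an element of A
    ([faithful_of_copresentation], [double_centralizer]). Conversely, the first two terms of a
    minimal injective resolution of A embed in Q0 and Q1 and split off, so they lie in add(G)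
    ([nu_domdim_ge2_of_copresentation]).

    The other ingredient links self-injectivity of H, in the form H in add(DH), to nu(G) in add(G).
    For G = Ae, multiplying nu(G) = D(eA) by e and dualising leads from the second condition to the
    first ([opcorner_self_injective]). For A = End_H(G) with H a summand of G, Hom_A(G, A) is
    Hom_H(G, H), so the first condition gives nu(G) in add(D Hom_H(G, DH)) = add(G)
    ([nakayama_end_mod_in_add]).

    When the dimension is at least 2, G is taken as an ideal Ae of maximal dimension: a candidate
    outside add(Ae) would yield an idempotent orthogonal to e that enlarges it
    ([maximal_projinj_idempotent]). When A = End_H(G), closure of add(G) under nu makes G strongly
    projective, and [strongly_projinj_injective] makes it injective. Membership in add is a
    factorisation of the identity ([through]), detected on projective modules by trace ideals
    ([in_add_trace]). *)

Section LinearAlgebra.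
Variables (k : fieldType) (U V : vectType k).

Lemma lker0_inj (f : 'Hom(U, V)) : lker f = 0%VS -> injective f.
Proof. by move/eqP/lker0P. Qed.

Lemma inj_lker0 (f : 'Hom(U, V)) :
  (forall x, f x = 0 -> x = 0) -> lker f = 0%VS.
Proof.
move=> f0; apply/eqP; rewrite -subv0; apply/subvP=> x.
by rewrite memv_ker => /eqP/f0->; apply: mem0v.
Qed.

Lemma coord_sum (x : U) :
  \sum_(i < \dim {:U}) coord (vbasis {:U}) i x *: (vbasis {:U})`_i = x.
Proof. by rewrite -coord_vbasis ?memvf. Qed.

End LinearAlgebra.

(** * Linear forms and double duality *)

Section DoubleDual.
Variables (k : fieldType) (V : vectType k).

Definition coord_form (i : 'I_(\dim {:V})) : 'Hom(V, k^o) :=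
  linfun (coord (vbasis {:V}) i : V -> k^o).

Lemma coord_formE i x : coord_form i x = coord (vbasis {:V}) i x.
Proof. by rewrite linfunE // => a u v; rewrite linearP. Qed.

Lemma form_sep (x y : V) : (forall f : 'Hom(V, k^o), f x = f y) -> x = y.
Proof.
move=> fxy; rewrite -(coord_sum x) -(coord_sum y); apply: eq_bigr => i _.
by rewrite -!coord_formE fxy.
Qed.

Lemma form_sum (f : 'Hom(V, k^o)) :
  f = \sum_(i < \dim {:V}) (f (vbasis {:V})`_i : k) *: coord_form i.
Proof.
apply/lfunP=> x; rewrite sum_lfunE -{1}(coord_sum x) linear_sum.
apply: eq_bigr => i _; rewrite linearZ scale_lfunE coord_formE.
exact: mulrC.
Qed.

(** The inverse of the evaluation isomorphism V -> DDV, in coordinates. *)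
Definition eval_point (L : 'Hom('Hom(V, k^o), k^o)) : V :=
  \sum_(i < \dim {:V}) (L (coord_form i) : k) *: (vbasis {:V})`_i.

Lemma eval_pointE L (f : 'Hom(V, k^o)) : f (eval_point L) = L f.
Proof.
rewrite /eval_point linear_sum {2}(form_sum f) linear_sum.
apply: eq_bigr => i _; rewrite !linearZ /=; exact: mulrC.
Qed.

End DoubleDual.

(** * Calculation rules for module actions *)

Section Actions.
Variables (k : fieldType) (A : falgType k) (M : amod A).

Definition act_vec (v : M) : 'Hom(A, M) := linfun (fun a => act M a v).

Lemma act_vecE v a : act_vec v a = act M a v.
Proof. by rewrite linfunE //; apply: act_linear_l. Qed.

Lemma actDr a u v : act M a (u + v) = act M a u + act M a v.
Proof. by rewrite -!act_endE linearD. Qed.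
Lemma actBr a u v : act M a (u - v) = act M a u - act M a v.
Proof. by rewrite -!act_endE linearB. Qed.
Lemma act0r a : act M a 0 = 0.
Proof. by rewrite -!act_endE linear0. Qed.
Lemma actZr a c u : act M a (c *: u) = c *: act M a u.
Proof. by rewrite -!act_endE linearZ. Qed.
Lemma act_sumr a I (r : seq I) (P : pred I) F :
  act M a (\sum_(i <- r | P i) F i) = \sum_(i <- r | P i) act M a (F i).
Proof.
by rewrite -act_endE linear_sum; apply: eq_bigr => i _; exact: act_endE.
Qed.
Lemma actDl a b v : act M (a + b) v = act M a v + act M b v.
Proof. by rewrite -!act_vecE linearD. Qed.
Lemma actBl a b v : act M (a - b) v = act M a v - act M b v.
Proof. by rewrite -!act_vecE linearB. Qed.
Lemma act0l v : act M 0 v = 0.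
Proof. by rewrite -!act_vecE linear0. Qed.
Lemma actZl c a v : act M (c *: a) v = c *: act M a v.
Proof. by rewrite -!act_vecE linearZ. Qed.
End Actions.

(** * Homomorphisms and additive closures *)

Section Homs.
Variables (k : fieldType) (A : falgType k).
Implicit Types (M N P Q I X Y : amod A) (C : amod A -> Prop).

Lemma hom_id M : is_hom (\1%VF : 'Hom(M, M)).
Proof. by move=> a v; rewrite !id_lfunE. Qed.

Lemma hom_comp M N P (g : 'Hom(N, P)) (f : 'Hom(M, N)) :
  is_hom g -> is_hom f -> is_hom (g \o f)%VF.
Proof. by move=> hg hf a v; rewrite !comp_lfunE hf hg. Qed.

Lemma hom_zero M N : is_hom (0 : 'Hom(M, N)).
Proof. by move=> a v; rewrite !zero_lfunE act0r. Qed.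

Lemma hom_add M N (f g : 'Hom(M, N)) : is_hom f -> is_hom g -> is_hom (f + g).
Proof. by move=> hf hg a v; rewrite !add_lfunE hf hg actDr. Qed.

Lemma hom_sum M N (J : Type) (r : seq J) (P : pred J) (F : J -> 'Hom(M, N)) :
  (forall i, is_hom (F i)) -> is_hom (\sum_(i <- r | P i) F i).
Proof.
move=> hF; elim/big_ind: _ => [|f g|i _]; [exact: hom_zero | exact: hom_add|].
exact: hF.
Qed.

Lemma hom_act_vec M (v : M) : is_hom (act_vec v : 'Hom(regular A, M)).
Proof. by move=> a b; rewrite !act_vecE actM. Qed.

Lemma limg_submodule M N (f : 'Hom(M, N)) : is_hom f -> submodule (limg f).
Proof.
move=> hf a _ /memv_imgP[v _ ->]; rewrite -hf; exact: memv_img (memvf _).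
Qed.

Lemma lker_submodule M N (f : 'Hom(M, N)) : is_hom f -> submodule (lker f).
Proof.
by move=> hf a v; rewrite !memv_ker hf => /eqP->; rewrite act0r.
Qed.

Lemma add_submodule M (U V : {vspace M}) :
  submodule U -> submodule V -> submodule (U + V)%VS.
Proof.
move=> hU hV a _ /memv_addP[u Uu [v Vv ->]].
by rewrite actDr memv_add ?hU ?hV.
Qed.

(* Factorisation through finite direct sums of modules in [C], written as a   *)
(* finite sum of composites; with [f = id] this gives membership in add(C).   *)
Inductive through C M N : 'Hom(M, N) -> Prop :=
| through0 : through C 0
| through_add Y (b : 'Hom(M, Y)) (a : 'Hom(Y, N)) f :
    C Y -> is_hom b -> is_hom a -> through C f ->
    through C ((a \o b)%VF + f).

Definition in_add C X := through C (\1%VF : 'Hom(X, X)).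

Lemma through_hom C M N (f : 'Hom(M, N)) : through C f -> is_hom f.
Proof.
elim=> [|Y b a g _ hb ha _ hg]; first exact: hom_zero.
by apply: hom_add => //; apply: hom_comp.
Qed.

Lemma through1 C M N Y (a : 'Hom(Y, N)) (b : 'Hom(M, Y)) :
  C Y -> is_hom b -> is_hom a -> through C (a \o b)%VF.
Proof.
by move=> CY hb ha; rewrite -[(_ \o _)%VF]addr0; apply: through_add => //;
  apply: through0.
Qed.

Lemma throughD C M N (f g : 'Hom(M, N)) :
  through C f -> through C g -> through C (f + g).
Proof.
move=> tf tg; elim: tf => [|Y b a f' CY hb ha _ IH]; first by rewrite add0r.
by rewrite -addrA; apply: through_add.
Qed.

Lemma through_sum C M N (J : Type) (r : seq J) (P : pred J)
    (F : J -> 'Hom(M, N)) :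
  (forall i, through C (F i)) -> through C (\sum_(i <- r | P i) F i).
Proof.
move=> hF; elim/big_ind: _ => [|f g|i _]; [exact: through0| exact: throughD|].
exact: hF.
Qed.

Lemma through_compl C M N P (h : 'Hom(N, P)) (f : 'Hom(M, N)) :
  is_hom h -> through C f -> through C (h \o f)%VF.
Proof.
move=> hh; elim=> [|Y b a g CY hb ha _ IH].
  by rewrite comp_lfun0r; apply: through0.
rewrite comp_lfunDr comp_lfunA; apply: through_add => //; exact: hom_comp.
Qed.

Lemma through_compr C M N P (h : 'Hom(P, M)) (f : 'Hom(M, N)) :
  is_hom h -> through C f -> through C (f \o h)%VF.
Proof.
move=> hh; elim=> [|Y b a g CY hb ha _ IH].
  by rewrite comp_lfun0l; apply: through0.
rewrite comp_lfunDl -comp_lfunA; apply: through_add => //; exact: hom_comp.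
Qed.

Lemma through_trans C D M N (f : 'Hom(M, N)) :
  (forall Y, C Y -> in_add D Y) -> through C f -> through D f.
Proof.
move=> CD; elim=> [|Y b a g CY hb ha _ IH]; first exact: through0.
apply: throughD => //.
rewrite -[b]comp_lfun1l; apply: through_compl => //.
by apply: through_compr => //; apply: CD.
Qed.

Lemma in_add_self C X : C X -> in_add C X.
Proof.
by move=> CX; rewrite /in_add -[\1%VF]comp_lfun1l; apply: through1 => //;
  apply: hom_id.
Qed.

Lemma in_add_trans C D X :
  (forall Y, C Y -> in_add D Y) -> in_add C X -> in_add D X.
Proof. exact: through_trans. Qed.

Lemma in_add_retract X Y (i : 'Hom(X, Y)) (p : 'Hom(Y, X)) :
  is_hom i -> is_hom p -> (forall x, p (i x) = x) -> in_add (eq Y) X.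
Proof.
move=> hi hp pi; rewrite /in_add.
have -> : \1%VF = (p \o i)%VF by apply/lfunP=> x; rewrite comp_lfunE id_lfunE.
exact: through1.
Qed.

Lemma projective_in_add C X :
  (forall Y, C Y -> projective_mod Y) -> in_add C X -> projective_mod X.
Proof.
move=> Cproj addX M N g f hg sg hf.
suff [h [hh gh]] : exists h : 'Hom(X, M), is_hom h /\ (g \o h = f \o \1)%VF.
  by exists h; rewrite gh comp_lfun1r.
elim: addX => [|Y b a f' CY hb ha _ [h [hh gh]]].
  by exists 0; rewrite !comp_lfun0r; split; first exact: hom_zero.
have [h1 [hh1 gh1]] := Cproj _ CY _ _ g (f \o a)%VF hg sg (hom_comp hf ha).
exists ((h1 \o b)%VF + h); split; first by apply/hom_add/hh/hom_comp.
by rewrite !comp_lfunDr gh !comp_lfunA gh1.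
Qed.

Lemma injective_in_add C X :
  (forall Y, C Y -> injective_mod Y) -> in_add C X -> injective_mod X.
Proof.
move=> Cinj addX M N g f hg ig hf.
suff [h [hh gh]] : exists h : 'Hom(N, X), is_hom h /\ (h \o g = \1 \o f)%VF.
  by exists h; rewrite gh comp_lfun1l.
elim: addX => [|Y b a f' CY hb ha _ [h [hh gh]]].
  by exists 0; rewrite !comp_lfun0l; split; first exact: hom_zero.
have [h1 [hh1 gh1]] := Cinj _ CY _ _ g (b \o f)%VF hg ig (hom_comp hb hf).
exists ((a \o h1)%VF + h); split; first by apply/hom_add/hh/hom_comp.
by rewrite !comp_lfunDl gh -!comp_lfunA gh1.
Qed.

(** * Submodules and extension of maps into injective modules *)

Section Submodule.
Variables (M : amod A) (U : {vspace M}) (hU : submodule U).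

Definition sub_act a (v : subvs_of U) : subvs_of U :=
  vsproj U (act M a (vsval v)).

Lemma sub_actE a v : vsval (sub_act a v) = act M a (vsval v).
Proof. by rewrite vsprojK //; apply: hU; apply: subvsP. Qed.

Fact sub_linear_l v : linear (fun a => sub_act a v).
Proof.
by move=> c a b; apply/val_inj; rewrite /= !sub_actE /= actDl actZl.
Qed.
Fact sub_linear_r a : linear (sub_act a).
Proof.
by move=> c u v; apply/val_inj; rewrite /= !sub_actE /= actDr actZr.
Qed.
Fact sub_act1 v : sub_act 1 v = v.
Proof. by apply/val_inj; rewrite /= sub_actE act1. Qed.
Fact sub_actM a b v : sub_act (a * b) v = sub_act a (sub_act b v).
Proof. by apply/val_inj; rewrite /= !sub_actE actM. Qed.

Definition submod : amod A :=
  AMod sub_linear_l sub_linear_r sub_act1 sub_actM.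

Definition sub_incl : 'Hom(submod, M) := linfun (vsval : submod -> M).

Lemma sub_inclE v : sub_incl v = vsval v.
Proof. by rewrite linfunE //; apply: linearP. Qed.

Lemma hom_sub_incl : is_hom sub_incl.
Proof. by move=> a v; rewrite !sub_inclE sub_actE. Qed.

Lemma lker_sub_incl : lker sub_incl = 0%VS.
Proof. by apply: inj_lker0 => x; rewrite sub_inclE => x0; apply/val_inj. Qed.

Lemma sub_corestr N (f : 'Hom(N, M)) :
  is_hom f -> (forall x, f x \in U) ->
  exists g : 'Hom(N, submod), is_hom g /\ forall x, sub_incl (g x) = f x.
Proof.
move=> hf fU.
have gL : linear (fun x => vsproj U (f x) : submod).
  by move=> c x y; rewrite !linearP.
have gE x : sub_incl (linfun (fun x => vsproj U (f x) : submod) x) = f x.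
  by rewrite linfunE // sub_inclE vsprojK.
eexists; split; last exact: gE.
move=> a v; apply: (lker0_inj lker_sub_incl).
by rewrite gE hom_sub_incl gE hf.
Qed.

End Submodule.

Lemma hom_inverse M N (f : 'Hom(M, N)) :
  is_hom f -> lker f = 0%VS -> limg f = fullv ->
  exists g : 'Hom(N, M), [/\ is_hom g, forall x, g (f x) = x
                          & forall y, f (g y) = y].
Proof.
move=> hf kf imf.
have gf x : (f^-1)%VF (f x) = x by rewrite lker0_lfunK ?kf.
have fg y : f ((f^-1)%VF y) = y by rewrite limg_lfunVK ?imf ?memvf.
exists (f^-1)%VF; split=> // a v; apply: (lker0_inj kf).
by rewrite fg hf fg.
Qed.

(** Since ker d lies in ker v, the map v descends to the image of d; injectivity of Q extends it
    along the inclusion of that image. This treats d as an embedding of M / ker d. *)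
Lemma injective_extend Q M N (d : 'Hom(M, N)) (v : 'Hom(M, Q)) :
  injective_mod Q -> is_hom d -> is_hom v -> (lker d <= lker v)%VS ->
  exists u : 'Hom(N, Q), is_hom u /\ forall x, u (d x) = v x.
Proof.
move=> injQ hd hv kdv.
have hI := limg_submodule hd.
pose w : 'Hom(submod hI, Q) := (v \o d^-1 \o sub_incl hI)%VF.
have dv x y : d x = d y -> v x = v y.
  move=> dxy; apply/eqP; rewrite -subr_eq0 -linearB -memv_ker.
  by apply: (subvP kdv); rewrite memv_ker linearB /= dxy subrr.
have wE x (y : submod hI) : vsval y = d x -> w y = v x.
  move=> yx; rewrite !comp_lfunE sub_inclE yx; apply: dv.
  by rewrite limg_lfunVK // memv_img ?memvf.
have hw : is_hom w.
  move=> a y; have /memv_imgP[x _ yx] := subvsP y.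
  rewrite (wE x y) // (wE (act M a x) (act _ a y)) ?hv //.
  by rewrite hd -yx sub_actE.
have [u [hu uw]] := injQ _ _ _ _ (@hom_sub_incl _ _ hI) (lker_sub_incl hI) hw.
exists u; split=> // x.
have xI : d x \in limg d by rewrite memv_img ?memvf.
rewrite -(wE x (vsproj _ (d x))) ?vsprojK // -uw comp_lfunE sub_inclE.
by rewrite vsprojK.
Qed.

Lemma essential_lker0 M I Q (d : 'Hom(M, I)) (u : 'Hom(I, Q)) :
  is_hom u -> essential (limg d) ->
  (forall x, u (d x) = 0 -> d x = 0) -> lker u = 0%VS.
Proof.
move=> hu ess ud; apply: ess; first exact: lker_submodule.
apply/eqP; rewrite -subv0; apply/subvP=> y /memv_capP[/memv_imgP[x _ ->]].
by rewrite memv_ker => /eqP/ud->; apply: mem0v.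
Qed.

Lemma injective_embedding_split I Q (u : 'Hom(I, Q)) :
  injective_mod I -> is_hom u -> lker u = 0%VS -> in_add (eq Q) I.
Proof.
move=> injI hu ku; have [p [hp pu]] := injI _ _ u \1%VF hu ku (@hom_id I).
apply: (in_add_retract hu hp) => x.
by move/lfunP/(_ x): pu; rewrite comp_lfunE id_lfunE.
Qed.

(** * Coinduced modules *)

Section Coinduced.
Variable W : vectType k.

Let coind_act (a : A) (f : 'Hom(A, W)) : 'Hom(A, W) := (f \o amulr a)%VF.

Fact coind_actE a f b : coind_act a f b = f (b * a).
Proof. by rewrite comp_lfunE lfunE. Qed.

Fact coind_linear_l f : linear (fun a => coind_act a f).
Proof.
move=> c a b; apply/lfunP=> x.
by rewrite add_lfunE scale_lfunE !coind_actE mulrDr -scalerAr linearP.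
Qed.
Fact coind_linear_r a : linear (coind_act a).
Proof.
by move=> c f g; rewrite /coind_act comp_lfunDl comp_lfunZl.
Qed.
Fact coind_act1 f : coind_act 1 f = f.
Proof. by apply/lfunP=> x; rewrite coind_actE mulr1. Qed.
Fact coind_actM a b f : coind_act (a * b) f = coind_act a (coind_act b f).
Proof. by apply/lfunP=> x; rewrite !coind_actE mulrA. Qed.

(** Hom_k(A, W) is right adjoint to the forgetful functor to vector spaces, with [coind_map] as the
    adjunction; for W = k it is the left module D(A). *)
Definition coind : amod A :=
  AMod coind_linear_l coind_linear_r coind_act1 coind_actM.

Lemma act_coindE a (f : coind) b :
  (act coind a f : 'Hom(A, W)) b = (f : 'Hom(A, W)) (b * a).
Proof. exact: coind_actE. Qed.

Definition coind_map M (F : 'Hom(M, W)) : 'Hom(M, coind) :=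
  linfun (fun m => (F \o act_vec m)%VF : coind).

Lemma coind_mapE M (F : 'Hom(M, W)) m b :
  (coind_map F m : 'Hom(A, W)) b = F (act M b m).
Proof.
rewrite linfunE; first by rewrite comp_lfunE act_vecE.
move=> c x y; apply/lfunP=> a.
by rewrite add_lfunE scale_lfunE !comp_lfunE !act_vecE actDr actZr linearP.
Qed.

Lemma hom_coind_map M (F : 'Hom(M, W)) : is_hom (coind_map F).
Proof.
by move=> a m; apply/lfunP=> b; rewrite act_coindE !coind_mapE actM.
Qed.

(** By adjunction the extension problem becomes one for linear maps, which composition with a linear
    left inverse of g solves. *)
Lemma coind_injective : injective_mod coind.
Proof.
move=> M N g f hg kg hf.
have FL : linear (fun m => (f m : 'Hom(A, W)) 1).
  by move=> c x y; rewrite linearP add_lfunE scale_lfunE.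
pose F := linfun (fun m => (f m : 'Hom(A, W)) 1).
exists (coind_map (F \o g^-1)%VF); split; first exact: hom_coind_map.
apply/lfunP=> m; apply/lfunP=> b.
rewrite comp_lfunE coind_mapE comp_lfunE -hg lker0_lfunK ?kg // linfunE //.
by rewrite hf act_coindE mul1r.
Qed.

End Coinduced.

(** * Powers of a module and dual bases of projective modules *)

Section Power.
Variables (W : vectType k) (X : amod A).

Let pow_act (a : A) (f : 'Hom(W, X)) : 'Hom(W, X) := (act_end X a \o f)%VF.

Fact pow_actE a f w : pow_act a f w = act X a (f w).
Proof. by rewrite comp_lfunE act_endE. Qed.

Fact pow_linear_l f : linear (fun a => pow_act a f).
Proof.
move=> c a b; apply/lfunP=> x.
by rewrite add_lfunE scale_lfunE !pow_actE actDl actZl.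
Qed.
Fact pow_linear_r a : linear (pow_act a).
Proof.
by move=> c f g; rewrite /pow_act comp_lfunDr comp_lfunZr.
Qed.
Fact pow_act1 f : pow_act 1 f = f.
Proof. by apply/lfunP=> x; rewrite pow_actE act1. Qed.
Fact pow_actM a b f : pow_act (a * b) f = pow_act a (pow_act b f).
Proof. by apply/lfunP=> x; rewrite !pow_actE actM. Qed.

(* X^(dim W), in the coordinate-free form Hom_k(W, X). *)
Definition power : amod A :=
  AMod pow_linear_l pow_linear_r pow_act1 pow_actM.

Lemma act_powerE a (f : power) w :
  (act power a f : 'Hom(W, X)) w = act X a ((f : 'Hom(W, X)) w).
Proof. exact: pow_actE. Qed.

Definition power_in (l : 'Hom(W, k^o)) : 'Hom(X, power) :=
  linfun (fun x => linfun (fun w => (l w : k) *: x) : power).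

Lemma power_inE l x w : (power_in l x : 'Hom(W, X)) w = (l w : k) *: x.
Proof.
have inL y : linear (fun w => (l w : k) *: y).
  by move=> c u v; rewrite linearP scalerDl -scalerA.
rewrite linfunE ?linfunE //.
move=> c u v; apply/lfunP=> z; rewrite add_lfunE scale_lfunE !linfunE //.
by rewrite scalerDr !scalerA mulrC.
Qed.

Lemma power_in_hom l : is_hom (power_in l).
Proof.
by move=> a x; apply/lfunP=> w; rewrite act_powerE !power_inE actZr.
Qed.

Definition power_out (w : W) : 'Hom(power, X) :=
  linfun (fun f : power => (f : 'Hom(W, X)) w).

Lemma power_outE w (f : power) : power_out w f = (f : 'Hom(W, X)) w.
Proof.
by rewrite linfunE // => c u v; rewrite add_lfunE scale_lfunE.
Qed.

Lemma power_out_hom w : is_hom (power_out w).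
Proof. by move=> a x; rewrite !power_outE act_powerE. Qed.

Lemma power_in_add : in_add (eq X) power.
Proof.
rewrite /in_add.
have -> : \1%VF = \sum_(i < \dim {:W})
    (power_in (coord_form i) \o power_out (vbasis {:W})`_i)%VF.
  apply/lfunP=> f; apply/lfunP=> w; rewrite sum_lfunE id_lfunE sum_lfunE.
  rewrite -{1}(coord_sum w) linear_sum; apply: eq_bigr => i _.
  by rewrite comp_lfunE power_inE power_outE linearZ coord_formE.
apply: through_sum => i; apply: through1 => //; last exact: power_in_hom.
exact: power_out_hom.
Qed.

End Power.

Lemma regular_projective : projective_mod (regular A).
Proof.
move=> M N g f hg sg hf.
have /memv_imgP[m _ mE] : f 1 \in limg g by rewrite sg memvf.
exists (act_vec m); split; first exact: hom_act_vec.
apply/lfunP=> a; rewrite comp_lfunE act_vecE hg -mE -hf.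
by congr (f _); rewrite /= mulr1.
Qed.

(** A linear basis of P gives a surjection onto P from a power of A. Projectivity splits it, and the
    coordinates of the section are the [eta i]. *)
Lemma dual_basis P : projective_mod P ->
  exists (n : nat) (s : 'I_n -> P) (eta : 'I_n -> 'Hom(P, regular A)),
    (forall i, is_hom (eta i)) /\
    forall x, x = \sum_i act P (eta i x) (s i).
Proof.
move=> projP; pose n := \dim {:P}.
pose b i := (vbasis {:P})`_i : P.
pose F := power P (regular A).
pose g : 'Hom(F, P) :=
  \sum_(i < n) (act_vec (b i) \o power_out (regular A) (b i))%VF.
have hg : is_hom g.
  apply: hom_sum => i; apply: (@hom_comp _ (regular A));
    [exact: hom_act_vec | exact: power_out_hom].
have gE f : g f = \sum_(i < n) act P ((f : 'Hom(P, regular A)) (b i)) (b i).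
  rewrite sum_lfunE; apply: eq_bigr => i _.
  by rewrite comp_lfunE act_vecE power_outE.
have sg : limg g = fullv.
  apply/eqP; rewrite eqEsubv subvf; apply/subvP=> x _.
  (* The form taking each basis vector to the matching coordinate of x, so that the element of the
     power that it defines is sent to x. *)
  pose l : 'Hom(P, k^o) := \sum_(i < n) coord (vbasis {:P}) i x *: coord_form i.
  apply/memv_imgP; exists (power_in (regular A) l (1 : A)); first exact: memvf.
  rewrite gE -{1}(coord_sum x); apply: eq_bigr => i _.
  rewrite power_inE actZl act1; congr (_ *: _).
  rewrite sum_lfunE (bigD1 i) //= big1 => [|j ji].
    rewrite addr0 scale_lfunE coord_formE coord_free ?(basis_free (vbasisP _)) //.
    by rewrite eqxx [RHS]mulr1.
  rewrite scale_lfunE coord_formE coord_free ?(basis_free (vbasisP _)) //.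
  by rewrite eq_sym (negPf ji) [LHS]mulr0.
have [h [hh gh]] := projP _ _ g \1%VF hg sg (@hom_id P).
exists n, (fun i => b i), (fun i => (power_out (regular A) (b i) \o h)%VF).
split=> [i|x]; first by apply: hom_comp => //; apply: power_out_hom.
move/lfunP/(_ x): gh; rewrite comp_lfunE id_lfunE gE => {1}<-.
by apply: eq_bigr => i _; rewrite comp_lfunE power_outE.
Qed.

End Homs.

(** * The Nakayama functor and its full faithfulness on projective modules *)

Section NakayamaFunctor.
Variables (k : fieldType) (A : falgType k).
Implicit Types (M N P Q I X Y Z G : amod A) (C : amod A -> Prop).

Notation star X := (subvs_of (homA X (regular A))).

Lemma star_hom X (eta : star X) : is_hom (vsval eta : 'Hom(X, regular A)).
Proof. exact/homAP/subvsP. Qed.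

Lemma star_exists X (f : 'Hom(X, regular A)) :
  is_hom f -> exists eta : star X, vsval eta = f.
Proof.
by move=> hf; exists (vsproj (homA X (regular A)) f); rewrite vsprojK //;
  apply/homAP.
Qed.

Lemma act_nakayamaE X a (F : nakayama X) (eta : star X) :
  (act (nakayama X) a F : 'Hom(star X, k^o)) eta
    = (F : 'Hom(star X, k^o)) (hom_mulr a eta).
Proof. exact: nakayama_actE. Qed.

Definition star_map X Y (f : 'Hom(X, Y)) : 'Hom(star Y, star X) :=
  linfun (fun eta : star Y =>
    vsproj (homA X (regular A)) (vsval eta \o f)%VF).

Lemma star_map_def X Y (f : 'Hom(X, Y)) (eta : star Y) :
  star_map f eta = vsproj (homA X (regular A)) (vsval eta \o f)%VF.
Proof.
rewrite linfunE // => c u v.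
by rewrite !linearP /= comp_lfunDl -comp_lfunZl linearP.
Qed.

Lemma star_mapE X Y (f : 'Hom(X, Y)) (eta : star Y) :
  is_hom f -> vsval (star_map f eta) = (vsval eta \o f)%VF.
Proof.
move=> hf; rewrite star_map_def vsprojK //; apply/homAP.
by apply: hom_comp => //; apply: star_hom.
Qed.

Definition nu_map X Y (f : 'Hom(X, Y)) : 'Hom(nakayama X, nakayama Y) :=
  linfun (fun F : nakayama X =>
    ((F : 'Hom(star X, k^o)) \o star_map f)%VF : nakayama Y).

Lemma nu_mapE X Y (f : 'Hom(X, Y)) (F : nakayama X) (eta : star Y) :
  (nu_map f F : 'Hom(star Y, k^o)) eta
    = (F : 'Hom(star X, k^o)) (star_map f eta).
Proof.
rewrite linfunE ?comp_lfunE // => c u v.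
by rewrite comp_lfunDl comp_lfunZl.
Qed.

Lemma nu_map_hom X Y (f : 'Hom(X, Y)) : is_hom f -> is_hom (nu_map f).
Proof.
move=> hf a F; apply/lfunP=> eta.
rewrite nu_mapE !act_nakayamaE nu_mapE; congr ((F : 'Hom(_, _)) _).
apply/val_inj/lfunP=> x.
by rewrite /= hom_mulrE !star_mapE // !comp_lfunE hom_mulrE.
Qed.

Lemma nu_map1 X : nu_map (\1%VF : 'Hom(X, X)) = \1%VF.
Proof.
apply/lfunP=> F; apply/lfunP=> eta; rewrite nu_mapE id_lfunE.
congr ((F : 'Hom(_, _)) _); apply/val_inj.
by rewrite /= star_mapE ?comp_lfun1r //; apply: hom_id.
Qed.

Lemma nu_map_comp X Y Z (g : 'Hom(Y, Z)) (f : 'Hom(X, Y)) :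
  is_hom g -> is_hom f -> nu_map (g \o f)%VF = (nu_map g \o nu_map f)%VF.
Proof.
move=> hg hf; apply/lfunP=> F; apply/lfunP=> eta.
rewrite comp_lfunE !nu_mapE; congr ((F : 'Hom(_, _)) _); apply/val_inj.
by rewrite /= !star_mapE ?comp_lfunA //; apply: hom_comp.
Qed.

Lemma nu_mapD X Y (f g : 'Hom(X, Y)) : nu_map (f + g) = nu_map f + nu_map g.
Proof.
apply/lfunP=> F; apply/lfunP=> eta.
rewrite add_lfunE add_lfunE !nu_mapE !star_map_def comp_lfunDr.
by rewrite !linearD.
Qed.

Lemma nu_map0 X Y : nu_map (0 : 'Hom(X, Y)) = 0.
Proof.
by apply: (addIr (nu_map 0)); rewrite -nu_mapD !add0r.
Qed.

Lemma through_nu C X Y (f : 'Hom(X, Y)) :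
  through C f -> through (fun Z => exists2 Y, C Y & nakayama Y = Z) (nu_map f).
Proof.
elim=> [|Z b a g CZ hb ha tg IH]; first by rewrite nu_map0; apply: through0.
rewrite nu_mapD nu_map_comp //; apply: through_add => //; last exact: nu_map_hom.
  by exists Z.
exact: nu_map_hom.
Qed.

Lemma in_add_nu C X :
  in_add C X -> in_add (fun Z => exists2 Y, C Y & nakayama Y = Z) (nakayama X).
Proof. by move/through_nu; rewrite nu_map1. Qed.

Lemma in_add_nu_eq X Y :
  in_add (eq Y) X -> in_add (eq (nakayama Y)) (nakayama X).
Proof.
move/in_add_nu; apply: in_add_trans => _ [_ <- <-]; exact: in_add_self.
Qed.

Lemma in_add_iter_nu C X i :
  (forall Y, C Y -> C (nakayama Y)) -> in_add C X ->
  in_add C (iter i (@nakayama k A) X).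
Proof.
move=> nuC addX; elim: i => //= i /in_add_nu.
by apply: in_add_trans => _ [Y CY <-]; apply/in_add_self/nuC.
Qed.

Lemma strongly_projinjP X :
  strongly_projinj X <-> forall i, projective_mod (iter i (@nakayama k A) X).
Proof.
by split=> [[p0 pS] [|i]|p]; [|exact: pS|split=> [|i _]; [exact: (p 0)|]].
Qed.

Lemma strongly_projinj_nu X :
  strongly_projinj X -> strongly_projinj (nakayama X).
Proof.
by move/strongly_projinjP=> p; apply/strongly_projinjP=> i; rewrite -iterSr.
Qed.

Lemma strongly_projinj_in_add C X :
  (forall Y, C Y -> strongly_projinj Y) -> in_add C X -> strongly_projinj X.
Proof.
move=> CS addX; apply/strongly_projinjP=> i.
apply: (@projective_in_add _ _ (@strongly_projinj k A)) => [Y []//|].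
apply: in_add_iter_nu; first exact: strongly_projinj_nu.
by apply: in_add_trans addX => Y CY; apply/in_add_self/CS.
Qed.

(** Evaluation at 1 identifies Hom_A(A, A) with A, which makes nu(A) a retract of the coinduced
    module D(A). *)
Lemma nakayama_regular_injective : injective_mod (nakayama (regular A)).
Proof.
pose one : star (regular A) := vsproj (homA _ (regular A)) \1%VF.
have oneE : vsval one = \1%VF by rewrite vsprojK //; apply/homAP/hom_id.
pose ev : 'Hom(nakayama (regular A), k^o) :=
  linfun (fun F : nakayama (regular A) => (F : 'Hom(star _, k^o)) one).
have evE F : ev F = (F : 'Hom(star _, k^o)) one.
  by rewrite linfunE // => c u v; rewrite add_lfunE scale_lfunE.
have evL (f : 'Hom(A, k^o)) :
    linear (fun eta : star (regular A) => f (vsval eta 1)).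
  by move=> c u v; rewrite linearP /= add_lfunE scale_lfunE linearP.
pose p : 'Hom(coind A k^o, nakayama (regular A)) :=
  linfun (fun f : coind A k^o =>
    linfun (fun eta : star (regular A) => (f : 'Hom(A, k^o)) (vsval eta 1))
    : nakayama (regular A)).
have pE (f : coind A k^o) (eta : star (regular A)) :
    (p f : 'Hom(star _, k^o)) eta = (f : 'Hom(A, k^o)) (vsval eta 1).
  rewrite linfunE ?linfunE // => c u v; apply/lfunP=> x.
  rewrite add_lfunE scale_lfunE !(linfunE (evL _)).
  by rewrite add_lfunE scale_lfunE.
have hp : is_hom p.
  move=> a f; apply/lfunP=> eta.
  rewrite act_nakayamaE !pE act_coindE; congr (f _).
  exact/esym/hom_mulrE.
apply: (@injective_in_add _ _ (eq (coind A k^o))) => [_ <-|].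
  exact: coind_injective.
apply: (in_add_retract (hom_coind_map ev) hp) => F; apply/lfunP=> eta.
rewrite pE coind_mapE evE act_nakayamaE; congr ((F : 'Hom(_, _)) _).
apply/val_inj/lfunP=> x; apply: etrans (hom_mulrE _ _ _) _.
rewrite oneE id_lfunE -[RHS](congr1 (vsval eta) (mulr1 x)).
exact/esym/star_hom.
Qed.

Lemma projective_in_add_regular P :
  projective_mod P -> in_add (eq (regular A)) P.
Proof.
case/dual_basis=> n [s [eta [heta sE]]]; rewrite /in_add.
have -> : \1%VF = \sum_i (act_vec (s i) \o eta i)%VF.
  apply/lfunP=> x; rewrite id_lfunE {1}(sE x) sum_lfunE.
  by apply: eq_bigr => i _; rewrite comp_lfunE act_vecE.
apply: through_sum => i; apply: (@through1 _ _ _ _ _ (regular A)) => //.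
exact: hom_act_vec.
Qed.

Lemma nakayama_injective P : projective_mod P -> injective_mod (nakayama P).
Proof.
move/projective_in_add_regular/in_add_nu_eq; apply: injective_in_add => _ <-.
exact: nakayama_regular_injective.
Qed.

(** Linear forms separate the points of Hom_A(X, A), so f and g induce the same map Hom_A(Y, A) ->
    Hom_A(X, A); a dual basis of Y recovers f and g from it. *)
Lemma nu_map_inj X Y (f g : 'Hom(X, Y)) : projective_mod Y ->
  is_hom f -> is_hom g -> nu_map f = nu_map g -> f = g.
Proof.
case/dual_basis=> n [s [eta [heta sE]]] hf hg fg; apply/lfunP=> x.
rewrite (sE (f x)) (sE (g x)); apply: eq_bigr => i _; congr (act _ _ _).
have [e <-] := star_exists (heta i).
suff /(congr1 (fun u : star X => vsval u x)) : star_map f e = star_map g e.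
  by rewrite !star_mapE // !comp_lfunE.
apply: form_sep => F; rewrite -(nu_mapE f F e) -(nu_mapE g F e).
by rewrite fg.
Qed.

(** By double duality h is the transpose of a map T from Hom_A(Y, A) to Hom_A(X, A). Linearity of h
    over A makes T right A-linear, and a dual basis of Y then exhibits T as precomposition with a
    map g. *)
Lemma nu_map_full X Y (h : 'Hom(nakayama X, nakayama Y)) :
  projective_mod Y -> is_hom h ->
  exists g : 'Hom(X, Y), is_hom g /\ nu_map g = h.
Proof.
case/dual_basis=> n [s [eta [heta sE]]] hh.
have GL (e : star Y) : linear (fun F : 'Hom(star X, k^o) =>
    (h (F : nakayama X) : 'Hom(star Y, k^o)) e).
  by move=> c u v; rewrite (linearP h) add_lfunE scale_lfunE.
pose T (e : star Y) : star X := eval_point (linfun (fun F : 'Hom(star X, k^o) =>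
    (h (F : nakayama X) : 'Hom(star Y, k^o)) e)).
have TE e (F : 'Hom(star X, k^o)) :
    F (T e) = (h (F : nakayama X) : 'Hom(star Y, k^o)) e.
  by rewrite eval_pointE linfunE.
pose eta' i : star Y := vsproj (homA Y (regular A)) (eta i).
have eta'E i : vsval (eta' i) = eta i by rewrite vsprojK //; apply/homAP.
pose g : 'Hom(X, Y) := \sum_i (act_vec (s i) \o vsval (T (eta' i)))%VF.
have hg : is_hom g.
  apply: hom_sum => i; apply: (@hom_comp _ _ _ (regular A)).
    exact: hom_act_vec.
  exact: star_hom.
exists g; split=> //; apply/lfunP=> F; apply/lfunP=> e.
rewrite nu_mapE.
(* Both e and its pullback along g are expanded over the dual basis with the same right coefficients
   e(s_i), so comparing them reduces to T at the [eta' i]. *)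
have -> : star_map g e = \sum_i hom_mulr (vsval e (s i)) (T (eta' i)).
  apply/val_inj/lfunP=> x; rewrite /= star_mapE // comp_lfunE sum_lfunE.
  rewrite !linear_sum /= sum_lfunE; apply: eq_bigr => i _.
  by rewrite comp_lfunE act_vecE hom_mulrE star_hom.
have {2}-> : e = \sum_i hom_mulr (vsval e (s i)) (eta' i).
  apply/val_inj/lfunP=> y; rewrite /= [in LHS](sE y) !linear_sum /= sum_lfunE.
  by apply: eq_bigr => i _; rewrite hom_mulrE star_hom eta'E.
rewrite !linear_sum; apply: eq_bigr => i _ /=.
by rewrite -act_nakayamaE TE hh act_nakayamaE.
Qed.

(** Full faithfulness lifts a factorisation of the identity of nu(X) term by term. *)
Lemma in_add_nu_reflect X Y : projective_mod X -> projective_mod Y ->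
  in_add (eq (nakayama Y)) (nakayama X) -> in_add (eq Y) X.
Proof.
move=> projX projY.
suff main (f : 'Hom(nakayama X, nakayama X)) : through (eq (nakayama Y)) f ->
    exists2 g : 'Hom(X, X), through (eq Y) g & nu_map g = f.
  case/main=> g tg g1; rewrite /in_add.
  suff -> : \1%VF = g by [].
  apply: nu_map_inj => //; [exact: hom_id | exact: through_hom tg |].
  by rewrite g1 nu_map1.
elim=> [|Z b a h eZ hb ha _ [g tg <-]].
  by exists 0; [exact: through0 | exact: nu_map0].
case: _ / eZ => {Z} in b a hb ha *.
have [b' [hb' <-]] := nu_map_full projY hb.
have [a' [ha' <-]] := nu_map_full projX ha.
exists ((a' \o b')%VF + g); first exact: through_add.
by rewrite nu_mapD nu_map_comp.
Qed.

(** * Trace ideals and the chain of the add(nu^i G) *)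

Section Trace.

Definition trace Y : {vspace regular A} :=
  (\sum_(i < \dim (homA Y (regular A)))
     limg ((vbasis (homA Y (regular A)))`_i : 'Hom(Y, regular A)))%VS.

Lemma mem_trace Y (eta : 'Hom(Y, regular A)) y : is_hom eta -> eta y \in trace Y.
Proof.
move/homAP/coord_vbasis=> ->; rewrite sum_lfunE; apply: memv_sumr => i _.
by rewrite scale_lfunE memvZ // memv_img ?memvf.
Qed.

(** Right multiplication by eta(y) is b |-> b y from A to Y, followed by eta. *)
Lemma through_trace Y (a : regular A) :
  a \in trace Y -> through (eq Y) (act_vec a : 'Hom(regular A, regular A)).
Proof.
case/memv_sumP=> u uE ->.
have -> : act_vec (\sum_i u i : regular A)
    = \sum_i act_vec (u i : regular A) :> 'Hom(regular A, regular A).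
  apply/lfunP=> b; rewrite act_vecE act_sumr sum_lfunE.
  by apply: eq_bigr => i _; rewrite act_vecE.
apply: through_sum => i; have /memv_imgP[y _ ->] := uE i isT.
set eta : 'Hom(Y, regular A) := _`_i.
have heta : is_hom eta by apply/homAP; rewrite vbasis_mem // memt_nth.
have -> : act_vec (eta y) = (eta \o act_vec y)%VF.
  by apply/lfunP=> b; rewrite comp_lfunE !act_vecE heta.
apply: through1 => //; exact: hom_act_vec.
Qed.

Lemma trace_sub X Y : in_add (eq Y) X -> (trace X <= trace Y)%VS.
Proof.
move=> addX; apply/subv_sumP=> i _; apply/subvP=> _ /memv_imgP[x _ ->].
set eta : 'Hom(X, regular A) := _`_i.
have heta : is_hom eta by apply/homAP; rewrite vbasis_mem // memt_nth.
suff {x} main (f : 'Hom(X, X)) x : through (eq Y) f -> eta (f x) \in trace Y.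
  by rewrite -[x]id_lfunE; apply: main.
elim=> [|Z b a g eZ hb ha _ IH]; first by rewrite zero_lfunE linear0 mem0v.
case: _ / eZ => {Z} in b a hb ha *.
rewrite add_lfunE linearD memvD //.
by have := mem_trace (b x) (hom_comp heta ha); rewrite !comp_lfunE.
Qed.

(** Expanding each s_i in x = sum eta_i(x) s_i once more by the dual basis puts a right
    multiplication by eta_l(s_i) in every term. These elements lie in the trace of X, hence in that
    of Y, so every term factors through Y. *)
Lemma in_add_trace X Y :
  projective_mod X -> (trace X <= trace Y)%VS -> in_add (eq Y) X.
Proof.
case/dual_basis=> n [s [eta [heta sE]]] tXY; rewrite /in_add.
have -> : \1%VF = \sum_i \sum_l
    (act_vec (s l) \o (act_vec (eta l (s i) : regular A) \o eta i))%VF.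
  apply/lfunP=> x; rewrite id_lfunE {1}(sE x) sum_lfunE.
  apply: eq_bigr => i _; rewrite {1}(sE (s i)) act_sumr sum_lfunE.
  apply: eq_bigr => l _; rewrite !comp_lfunE !act_vecE -actM.
  by rewrite (act_vecE (eta l (s i) : regular A)).
apply: through_sum => i; apply: through_sum => l.
apply: (@through_compl _ _ _ _ (regular A)); first exact: hom_act_vec.
apply: (@through_compr _ _ _ (regular A)) => //.
apply: through_trace; apply: (subvP tXY).
exact: mem_trace.
Qed.

End Trace.

Lemma nat_seq_stationary (u : nat -> nat) :
  (forall i, u i.+1 <= u i)%N -> exists i, u i.+1 = u i.
Proof.
move: {2}(u 0) (leqnn (u 0)) => n; elim: n u => [|n IH] u u0 dec.
  by exists 0; apply/eqP; rewrite eqn_leq dec (leq_trans u0).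
have := dec 0; rewrite leq_eqVlt => /predU1P[u10|u1]; first by exists 0.
have [|i|i] := IH (fun i => u i.+1); [|exact: dec|by exists i.+1].
by rewrite -ltnS (leq_trans u1).
Qed.

(* If [nu G] lies in [add G], the traces of the [nu^i G] decrease, hence       *)
(* become stationary; since [nu] is fully faithful on projectives, the        *)
(* resulting [nu^i G \in add (nu^(i+1) G)] descends to [i = 0].                *)
Lemma strongly_projinj_injective G :
  strongly_projinj G -> in_add (eq G) (nakayama G) -> injective_mod G.
Proof.
move/strongly_projinjP=> projG addG; pose X i := iter i (@nakayama k A) G.
have addX i : in_add (eq (X i)) (X i.+1).
  by elim: i => //= i /in_add_nu_eq.
have [i ti] := nat_seq_stationary (fun i => dimvS (trace_sub (addX i))).
have : in_add (eq (X i.+1)) (X i).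
  apply: in_add_trace; first exact: projG.
  by rewrite -(geq_leqif (dimv_leqif_sup (trace_sub (addX i)))) ti.
elim: i {ti} => [|i IH].
  apply: injective_in_add => _ <-; exact: nakayama_injective (projG 0).
by move=> addXi; apply: IH; apply: (in_add_nu_reflect (projG i) (projG i.+1)).
Qed.

End NakayamaFunctor.

(** * Extremal natural numbers for arbitrary predicates *)

Section Minimum.

Lemma exists_min_nat (P : nat -> Prop) :
  (exists n, P n) -> exists n, P n /\ forall m, P m -> (n <= m)%N.
Proof.
case=> n; have [b] := ubnP n; elim: b n => // b IH n nb Pn.
have [[m [Pm mn]]|nex] := Classical_Prop.classic (exists m, P m /\ (m < n)%N).
  by apply: (IH m) Pm; apply: leq_trans mn _.
exists n; split=> // m Pm; rewrite leqNgt; apply/negP=> mn.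
by apply: nex; exists m.
Qed.

Lemma exists_max_nat (P : nat -> Prop) b :
  (exists n, P n) -> (forall n, P n -> (n <= b)%N) ->
  exists n, P n /\ forall m, P m -> (m <= n)%N.
Proof.
move=> [n0 Pn0] Pb.
have [|d [[n [Pn dE]] dmin]] :=
    @exists_min_nat (fun d => exists n, P n /\ d = (b - n)%N).
  by exists (b - n0)%N, n0.
exists n; split=> // m Pm.
have := dmin (b - m)%N (ex_intro _ m (conj Pm erefl)).
by rewrite dE leq_sub2lE ?Pb.
Qed.

End Minimum.

(** * Injective envelopes, minimal resolutions and dominant dimension *)

Section InjectiveEnvelope.
Variables (k : fieldType) (A : falgType k).
Implicit Types (M N Q I E : amod A).

(** The class of m modulo U is represented by m minus its projection to U; the map sends m to the
    function b |-> class of b m. Its kernel is U because U is a submodule, so it embeds M / U. *)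
Lemma quotient_coind_embedding M (U : {vspace M}) : submodule U ->
  exists Q (g : 'Hom(M, Q)), [/\ injective_mod Q, is_hom g & lker g = U].
Proof.
move=> hU; pose g := coind_map (\1 - projv U : 'Hom(M, M))%VF.
exists (coind A M), g; split; [exact: coind_injective|exact: hom_coind_map|].
have gE m b : (g m : 'Hom(A, M)) b = act M b m - projv U (act M b m).
  by rewrite coind_mapE add_lfunE opp_lfunE id_lfunE.
apply/vspaceP=> m; rewrite memv_ker; apply/eqP/idP => [gm0|mU].
  have := congr1 (fun f : 'Hom(A, M) => f 1) gm0.
  rewrite gE act1 zero_lfunE => /eqP; rewrite subr_eq0 => /eqP->.
  exact: memv_proj.
by apply/lfunP=> b; rewrite gE zero_lfunE projv_id ?subrr // hU.
Qed.

Lemma dsum_hom M N Q (f : 'Hom(M, Q)) (g : 'Hom(N, Q)) :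
  is_hom f -> is_hom g ->
  exists h : 'Hom(dsum M N, Q), is_hom h /\ forall x y, h (x, y) = f x + g y.
Proof.
move=> hf hg; pose F (v : dsum M N) := f v.1 + g v.2.
have FL : linear F.
  by move=> c u v; rewrite /F /= !linearP scalerDr addrACA.
exists (linfun F); split=> [a v|x y]; rewrite !linfunE //.
by rewrite /F /= hf hg actDr.
Qed.

(* Among the endomorphisms of an injective module [Q] fixing the image of [M] *)
(* pointwise, one of minimal rank has an injective envelope of that image as  *)
(* its range.                                                                 *)
Lemma injective_envelope M (U : {vspace M}) : submodule U ->
  exists E (f : 'Hom(M, E)),
    [/\ injective_mod E, is_hom f, lker f = U & essential (limg f)].
Proof.
case/quotient_coind_embedding=> Q [g [injQ hg kg]].
pose R (h : 'Hom(Q, Q)) := is_hom h /\ forall x, h (g x) = g x.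
have [|r [[h [[hh hgx] rE]] rmin]] :=
    @exists_min_nat (fun r => exists h, R h /\ r = \dim (limg h)).
  exists (\dim (limg (\1%VF : 'Hom(Q, Q)))), \1%VF; split=> //.
  by split=> [|x]; [apply: hom_id | rewrite id_lfunE].
(* If u fixes the image of g, then u h also competes for minimal rank, so u cannot lower the rank of
   h and is injective on its image. *)
have cap0 u : is_hom u -> (forall x, u (g x) = g x) ->
    forall y, y \in limg h -> u y = 0 -> y = 0.
  move=> hu ugx y yh uy.
  have := rmin (\dim (limg (u \o h)%VF)).
  rewrite limg_comp rE -{1}(limg_ker_dim u (limg h)) => dimle.
  have {dimle}: (\dim (limg h :&: lker u) + \dim (u @: limg h)
                  <= \dim (u @: limg h))%N.
    apply: dimle; exists (u \o h)%VF; rewrite limg_comp; split=> //.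
    by split=> [|x]; [apply: hom_comp | rewrite comp_lfunE hgx].
  rewrite -[leqRHS]add0n leq_add2r leqn0 dimv_eq0 => /eqP cap.
  apply/eqP; rewrite -memv0 -cap memv_cap yh memv_ker; exact/eqP.
have hI := limg_submodule hh; pose i := sub_incl hI.
have iI := lker0_inj (lker_sub_incl hI).
have hi : is_hom i := @hom_sub_incl _ _ _ _ hI.
have ih x : i x \in limg h by rewrite sub_inclE subvsP.
have [f [hf fE]] : exists f : 'Hom(M, submod hI),
    is_hom f /\ forall x, i (f x) = g x.
  by apply: sub_corestr => // x; rewrite -hgx memv_img ?memvf.
have [c [hc cE]] : exists c : 'Hom(Q, submod hI),
    is_hom c /\ forall x, i (c x) = h x.
  by apply: sub_corestr => // x; rewrite memv_img ?memvf.
have kci : lker (c \o i)%VF = 0%VS.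
  apply: inj_lker0 => x; rewrite comp_lfunE => cix; apply: iI.
  by rewrite linear0; apply: (cap0 h) => //; rewrite -cE cix linear0.
have [r0 [hr0 r0K _]] :=
  hom_inverse (hom_comp hc hi) kci (lker0_limgf (introT eqP kci)).
exists (submod hI), f; split=> //.
- apply: (@injective_in_add _ _ (eq Q)) => [_ <- //|].
  apply: (in_add_retract hi (hom_comp hr0 hc)) => x.
  by rewrite comp_lfunE -[RHS]r0K comp_lfunE.
- apply/vspaceP=> x; rewrite -kg !memv_ker; apply/eqP/eqP=> [fx|gx].
    by rewrite -fE fx linear0.
  by apply: iI; rewrite fE gx linear0.
move=> V hV capV.
have hiV := @hom_sub_incl _ _ _ _ hV.
(* The map that is g on M and 0 on V factors through the sum of their images in Q because V misses
   the image of f. Its extension u to Q fixes the image of g and kills V, so [cap0] gives V = 0. *)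
have [d [hd dE]] := dsum_hom hg (hom_comp hi hiV).
have [v [hv vE]] := dsum_hom hg (@hom_zero _ _ (submod hV) Q).
have [|u [hu ud]] := injective_extend injQ hd hv.
  apply/subvP=> -[x y]; rewrite !memv_ker dE vE zero_lfunE addr0 => /eqP.
  rewrite comp_lfunE -fE -linearD => dxy.
  have /eqP : f x + sub_incl hV y = 0 by apply: iI; rewrite dxy linear0.
  rewrite addr_eq0 => /eqP fx.
  suff /eqP-> : f x == 0 by rewrite linear0.
  rewrite -memv0 -capV memv_cap memv_img ?memvf // fx memvN sub_inclE.
  exact: subvsP.
have ugx x : u (g x) = g x.
  by have := ud (x, 0); rewrite dE vE !linear0 !addr0.
apply/eqP; rewrite -subv0; apply/subvP=> y yV; rewrite memv0; apply/eqP.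
apply: iI; rewrite linear0; apply: (cap0 u) => //.
have := ud (0, vsproj V y); rewrite dE vE !linear0 add0r zero_lfunE add0r.
by rewrite comp_lfunE sub_inclE vsprojK.
Qed.

(** A stage stands for the quotient of [stage_mod] by [stage_sub], whose envelope is a map out of
    [stage_mod] with kernel [stage_sub]. The next stage stands for the cokernel of that map, so
    iteration runs through the cosyzygies. *)
Record stage := Stage {
  stage_mod : amod A;
  stage_sub : {vspace stage_mod};
  stage_submodule : submodule stage_sub }.

Let envelope_spec s (p : {E : amod A & 'Hom(stage_mod s, E)}) :=
  [/\ injective_mod (projT1 p), is_hom (projT2 p),
      lker (projT2 p) = stage_sub s & essential (limg (projT2 p))].

Fact envelope_exists s : exists p, @envelope_spec s p.
Proof.
have [E [f Ef]] := injective_envelope (@stage_submodule s).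
by exists (existT _ E f).
Qed.

Definition envelope s :=
  IndefiniteDescription.constructive_indefinite_description _
    (envelope_exists s).

Fact envelope_hom s : is_hom (projT2 (sval (envelope s))).
Proof. by case: (svalP (envelope s)). Qed.

Definition next_stage s : stage := Stage (limg_submodule (@envelope_hom s)).

Lemma minimal_injective_resolution_exists M :
  exists (J : nat -> amod A) (eps : 'Hom(M, J 0))
         (d : forall n, 'Hom(J n, J n.+1)), minimal_injective_resolution eps d.
Proof.
have sub0 : submodule (0%VS : {vspace M}).
  by move=> a v; rewrite !memv0 => /eqP->; rewrite act0r.
pose s n := iter n next_stage (Stage sub0).
exists (fun n => stage_mod (s n.+1)), (projT2 (sval (envelope (s 0)))),
  (fun n => projT2 (sval (envelope (s n.+1)))).
have spec n := svalP (envelope (s n)).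
split; last by move=> n; case: (spec n.+1).
  split; last by move=> n; case: (spec n.+2).
  - by move=> n; case: (spec n).
  - split=> [|n]; first exact: (@envelope_hom (s 0)).
    exact: (@envelope_hom (s n.+1)).
  - by case: (spec 0).
  - by case: (spec 1).
by case: (spec 0).
Qed.

(** Either all terms are strongly projective and the value is infinite, or some b fails and bounds
    the lengths of the good initial segments, so a largest one exists. *)
Lemma nu_domdim_ge_of_resolution (J : nat -> amod A)
    (eps : 'Hom(regular A, J 0)) (d : forall n, 'Hom(J n, J n.+1)) n :
  minimal_injective_resolution eps d -> strongly_projinj_below J n ->
  nu_domdim_ge A n.
Proof.
move=> res Jn.
have [all_m|/Classical_Pred_Type.not_all_ex_not[b Jb]] :=
    Classical_Prop.classic (forall m, strongly_projinj_below J m).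
  by exists None; split=> //; exists J, eps, d.
have [||m [Jm mmax]] := @exists_max_nat (strongly_projinj_below J) b.
- by exists n.
- move=> m Jm; rewrite leqNgt; apply/negP=> bm; apply: Jb => i ib.
  by apply: Jm; apply: ltn_trans bm.
by exists (Some m); split; [exists J, eps, d | exact: mmax].
Qed.

(** The resolution maps to the copresentation by injectivity of Q0 and Q1. Exactness and
    essentiality make the comparison maps J 0 -> Q0 and J 1 -> Q1 injective, hence split. *)
Lemma nu_domdim_ge2_of_copresentation Q0 Q1
    (v : 'Hom(regular A, Q0)) (w : 'Hom(Q0, Q1)) :
  injective_mod Q0 -> injective_mod Q1 ->
  strongly_projinj Q0 -> strongly_projinj Q1 ->
  is_hom v -> is_hom w -> lker v = 0%VS -> limg v = lker w ->
  nu_domdim_ge A 2.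
Proof.
move=> inj0 inj1 sp0 sp1 hv hw kv vw.
have [J [eps [d res]]] := minimal_injective_resolution_exists (regular A).
have [[Jinj [heps hd] keps eps0 _] ess0 essS] := res.
have [|u0 [hu0 u0E]] := injective_extend inj0 heps hv.
  by rewrite keps sub0v.
have ku0 : lker u0 = 0%VS.
  apply: (essential_lker0 hu0 ess0) => x; rewrite u0E => vx.
  by rewrite (lker0_inj kv (etrans vx (esym (linear0 v)))) linear0.
have [|u1 [hu1 u1E]] := injective_extend inj1 (hd 0) (hom_comp hw hu0).
  rewrite -eps0; apply/subvP=> _ /memv_imgP[x _ ->].
  by rewrite memv_ker comp_lfunE u0E -memv_ker -vw memv_img ?memvf.
have ku1 : lker u1 = 0%VS.
  apply: (essential_lker0 hu1 (essS 0)) => y; rewrite u1E comp_lfunE => wu0.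
  have : u0 y \in limg v by rewrite vw memv_ker wu0.
  case/memv_imgP=> x _; rewrite -u0E => /(lker0_inj ku0)->.
  by apply/eqP; rewrite -memv_ker -eps0 memv_img ?memvf.
apply: (nu_domdim_ge_of_resolution res) => -[|[|//]] _.
  apply: strongly_projinj_in_add (injective_embedding_split (Jinj 0) hu0 ku0).
  by move=> _ <-.
apply: strongly_projinj_in_add (injective_embedding_split (Jinj 1) hu1 ku1).
by move=> _ <-.
Qed.

End InjectiveEnvelope.

(** * Endomorphism algebras over self-injective algebras *)

Lemma coind_map_linear (k : fieldType) (A : falgType k) (W : vectType k)
  (M : amod A) : linear (@coind_map k A W M).
Proof.
move=> c f g; apply/lfunP=> x; apply/lfunP=> b.
by rewrite add_lfunE scale_lfunE add_lfunE scale_lfunE !coind_mapE add_lfunE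
  scale_lfunE.
Qed.

Lemma coind_in_add (k : fieldType) (A : falgType k) (W : vectType k) :
  in_add (eq (coind A k^o)) (coind A W).
Proof.
have oL i : linear (fun f : coind A W => coord_form i ((f : 'Hom(A, W)) 1)).
  by move=> c u v; rewrite add_lfunE scale_lfunE linearP.
have iL (w : W) :
    linear (fun f : coind A k^o => ((f : 'Hom(A, k^o)) 1 : k) *: w).
  by move=> c u v; rewrite add_lfunE scale_lfunE scalerDl -scalerA.
rewrite /in_add; have -> : \1%VF = \sum_(i < \dim {:W})
    (coind_map (linfun (fun f : coind A k^o =>
       ((f : 'Hom(A, k^o)) 1 : k) *: (vbasis {:W})`_i)) \o
     coind_map (linfun (fun f : coind A W =>
       coord_form i ((f : 'Hom(A, W)) 1))))%VF.
  apply/lfunP=> f; apply/lfunP=> b; rewrite id_lfunE sum_lfunE sum_lfunE.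
  rewrite -[LHS](coord_sum); apply: eq_bigr => i _.
  rewrite comp_lfunE coind_mapE linfunE // act_coindE coind_mapE linfunE //.
  by rewrite act_coindE !mul1r coord_formE.
apply: through_sum => i; apply: through1 => //; exact: hom_coind_map.
Qed.

(** The embedding of H into Hom_k(H, H), x |-> (b |-> b x), splits since H is injective, and a basis
    decomposes the target into copies of DH. *)
Lemma self_injective_in_add (k : fieldType) (H : falgType k) :
  self_injective H -> in_add (eq (coind H k^o)) (regular H).
Proof.
move=> injH; pose u := coind_map (\1%VF : 'Hom(regular H, regular H)).
apply: (@in_add_trans _ _ (eq (coind H (regular H)))) => [_ <-|].
  exact: coind_in_add.
apply: (injective_embedding_split injH (@hom_coind_map _ _ _ _ _ : is_hom u)).
apply: inj_lker0 => x ux.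
have := congr1 (fun f : 'Hom(H, regular H) => f 1) ux.
by rewrite coind_mapE id_lfunE zero_lfunE act1.
Qed.

Section EndomorphismAlgebra.
Variables (k : fieldType) (A H : falgType k) (G : amod H).
(** The pair (s, pi) with pi(s) = 1 expresses that H is a direct summand of G. *)
Variables (s : G) (pi : 'Hom(G, regular H)).
Hypotheses (hpi : is_hom pi) (pi_s : pi s = 1).
Variable phi : 'Hom(A, 'End(G)).
Hypotheses (phi0 : lker phi = 0%VS) (phiG : limg phi = homA G G).
Hypotheses (phi1 : phi 1 = \1%VF).
Hypothesis phiM : forall a b, phi (a * b) = (phi a \o phi b)%VF.

Fact end_linear_l x : linear (fun a => phi a x).
Proof. by move=> c a b; rewrite linearP add_lfunE scale_lfunE. Qed.
Fact end_linear_r a : linear (phi a).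
Proof. exact: linearP. Qed.
Fact end_act1 x : phi 1 x = x.
Proof. by rewrite phi1 id_lfunE. Qed.
Fact end_actM a b x : phi (a * b) x = phi a (phi b x).
Proof. by rewrite phiM comp_lfunE. Qed.

Definition end_mod : amod A := AMod end_linear_l end_linear_r end_act1 end_actM.

Lemma act_end_modE a x : act end_mod a x = phi a x. Proof. by []. Qed.

Lemma phi_hom a : is_hom (phi a).
Proof. by apply/homAP; rewrite -phiG memv_img ?memvf. Qed.

Lemma phi_surj (f : 'End(G)) : is_hom f -> phi ((phi^-1)%VF f) = f.
Proof. by move/homAP=> hf; rewrite limg_lfunVK // phiG. Qed.

Lemma phi_inj : injective phi. Proof. exact: lker0_inj. Qed.

(** To tau in Hom_H(G, H) corresponds the map G -> A sending x to the endomorphism y |-> tau(y)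
    x. *)
Definition end_form (tau : 'Hom(G, regular H)) : 'Hom(end_mod, regular A) :=
  linfun (fun x : end_mod => (phi^-1)%VF (act_vec (x : G) \o tau)%VF : regular A).

Lemma end_formE tau x : is_hom tau ->
  phi (end_form tau x) = (act_vec (x : G) \o tau)%VF.
Proof.
move=> ht; have lin : linear (fun x : G => (act_vec x \o tau)%VF).
  move=> c u v; apply/lfunP=> y.
  by rewrite add_lfunE scale_lfunE !comp_lfunE !act_vecE actDr actZr.
rewrite linfunE => [|c u v]; last by rewrite lin linearP.
by rewrite phi_surj //; apply: (@hom_comp _ _ _ (regular H)) => //;
  apply: hom_act_vec.
Qed.

Lemma hom_end_form tau : is_hom tau -> is_hom (end_form tau).
Proof.
move=> ht a x; apply: phi_inj; rewrite phiM !end_formE //.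
apply/lfunP=> y; rewrite !comp_lfunE !act_vecE act_end_modE.
by rewrite phi_hom.
Qed.

Notation starG := (subvs_of (homA end_mod (regular A))).

Definition end_star (tau : 'Hom(G, regular H)) : starG :=
  vsproj (homA end_mod (regular A)) (end_form tau).

Lemma end_starE tau x : is_hom tau ->
  phi (vsval (end_star tau) x) = (act_vec (x : G) \o tau)%VF.
Proof.
by move=> ht; rewrite vsprojK ?end_formE //; apply/homAP/hom_end_form.
Qed.

Lemma end_starP c tau tau' : is_hom tau -> is_hom tau' ->
  end_star (c *: tau + tau') = c *: end_star tau + end_star tau'.
Proof.
move=> ht ht'; apply/val_inj/lfunP=> x; apply: phi_inj.
rewrite /= add_lfunE scale_lfunE linearP /= !end_starE //.
  by rewrite comp_lfunDr -comp_lfunZr.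
by apply: hom_add => // a y; rewrite !scale_lfunE ht actZr.
Qed.

Definition end_coord (eta : starG) : 'Hom(G, regular H) :=
  (pi \o phi (vsval eta s))%VF.

Lemma hom_end_coord eta : is_hom (end_coord eta).
Proof. by apply: hom_comp => //; apply: phi_hom. Qed.

(** Every x is ([end_form pi x]) applied to s, so eta(x) is [end_form pi x] times eta(s): eta is
    determined by eta(s), and only its composite with pi enters. *)
Lemma end_coordK eta : end_star (end_coord eta) = eta.
Proof.
apply/val_inj/lfunP=> x; apply: phi_inj.
rewrite end_starE; last exact: hom_end_coord.
have xE : act end_mod (end_form pi x) s = x.
  by rewrite act_end_modE end_formE // comp_lfunE pi_s act_vecE act1.
rewrite -{2}xE star_hom phiM end_formE //.
by apply/lfunP=> y; rewrite !comp_lfunE.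
Qed.

Lemma end_mod_projective : projective_mod end_mod.
Proof.
apply: (@projective_in_add _ _ (eq (regular A))) => [_ <-|].
  exact: regular_projective.
apply: (@in_add_retract _ _ end_mod (regular A) (end_form pi)
  (act_vec (s : end_mod)) (hom_end_form hpi)).
  exact: hom_act_vec.
move=> x; rewrite act_vecE act_end_modE end_formE // comp_lfunE pi_s.
by rewrite act_vecE act1.
Qed.

(** View nu(G) as D Hom_H(G, H). A map b : DH -> H induces nu(G) -> D Hom_H(G, DH) = DDG = G, and a
    map a : H -> DH induces a map back, so composites b a yield endomorphisms of nu(G) through G.
    The explicit formula for n is carried along so that f = 1 gives n = 1. *)
Lemma nakayama_end_mod_through (f : 'Hom(regular H, regular H)) :
  through (eq (coind H k^o)) f ->
  exists2 n : 'Hom(nakayama end_mod, nakayama end_mod),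
    through (eq end_mod) n &
    forall F eta, (n F : 'Hom(starG, k^o)) eta =
      (F : 'Hom(starG, k^o)) (end_star (f \o end_coord eta)%VF).
Proof.
elim=> [|Z a b g eZ ha hb tg [n tn nE]].
  exists 0; first exact: through0.
  move=> F eta; rewrite !zero_lfunE comp_lfun0l.
  suff -> : end_star 0 = 0 by rewrite linear0.
  have := end_starP 1 (@hom_zero _ _ G (regular H)) (@hom_zero _ _ G _).
  rewrite scaler0 addr0 scale1r => e0.
  by apply: (addrI (end_star 0)); rewrite addr0 -e0.
case: _ / eZ => {Z} in a b ha hb *.
have hbt f' : is_hom (b \o coind_map (f' : 'Hom(G, k^o)))%VF.
  by apply: hom_comp => //; apply: hom_coind_map.
have LL (F : nakayama end_mod) : linear (fun f' : 'Hom(G, k^o) =>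
    (F : 'Hom(starG, k^o)) (end_star (b \o coind_map f')%VF)).
  move=> c u v; rewrite coind_map_linear comp_lfunDr -comp_lfunZr.
  by rewrite end_starP // linearP.
(* A form f' on G is the H-map [coind_map f'] from G to DH; sending f' to F of its composite with b
   is an element of DDG, that is, a point of G. *)
pose D (F : nakayama end_mod) : end_mod := eval_point (linfun
  (fun f' : 'Hom(G, k^o) =>
    (F : 'Hom(starG, k^o)) (end_star (b \o coind_map f')%VF))).
have DE F (f' : 'Hom(G, k^o)) :
    f' (D F) = (F : 'Hom(starG, k^o)) (end_star (b \o coind_map f')%VF).
  by rewrite eval_pointE linfunE.
have DL : linear D.
  move=> c u v; apply: form_sep => f'.
  by rewrite linearP /= !DE add_lfunE scale_lfunE.
pose delta : 'Hom(nakayama end_mod, end_mod) := linfun D.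
have hdelta : is_hom delta.
  move=> t F; rewrite !linfunE //; apply: form_sep => f'.
  rewrite DE act_nakayamaE act_end_modE -comp_lfunE (DE F (f' \o phi t)%VF).
  congr ((F : 'Hom(_, _)) _); apply/val_inj/lfunP=> x; apply: phi_inj.
  apply: etrans (congr1 phi (hom_mulrE _ _ _)) _.
  rewrite phiM !end_starE //; apply/lfunP=> y.
  rewrite !comp_lfunE; congr (act_vec (x : G) (b _)); apply/lfunP=> c.
  by rewrite !coind_mapE comp_lfunE phi_hom.
(* The form on G that corresponds by adjunction to the H-map a o [end_coord eta] from G to DH. *)
pose point (eta : starG) : 'Hom(G, k^o) :=
  linfun (fun x : G => (a (end_coord eta x) : 'Hom(H, k^o)) 1).
have pointE eta x : point eta x = (a (end_coord eta x) : 'Hom(H, k^o)) 1.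
  by rewrite linfunE // => c u v; rewrite !linearP add_lfunE scale_lfunE.
have coordP c u v x : end_coord (c *: u + v) x
    = c *: end_coord u x + end_coord v x.
  rewrite !comp_lfunE -linearP; congr (pi _).
  by rewrite linearP add_lfunE scale_lfunE linearP add_lfunE scale_lfunE.
have gammaL1 x : linear (fun eta => point eta x).
  by move=> c u v; rewrite !pointE coordP linearP add_lfunE scale_lfunE.
pose gamma : 'Hom(end_mod, nakayama end_mod) :=
  linfun (fun x : end_mod => linfun (fun eta => point eta x) : nakayama end_mod).
have gammaE x eta : (gamma x : 'Hom(starG, k^o)) eta = point eta x.
  rewrite linfunE ?(linfunE (gammaL1 x)) // => c u v; apply/lfunP=> y.
  by rewrite add_lfunE scale_lfunE !(linfunE (gammaL1 _)) linearP.
have hgamma : is_hom gamma.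
  move=> t x; apply/lfunP=> eta; rewrite act_nakayamaE !gammaE !pointE.
  congr ((a _ : 'Hom(_, _)) _); rewrite !comp_lfunE hom_mulrE phiM comp_lfunE.
  by [].
exists ((gamma \o delta)%VF + n); first exact: through_add.
move=> F eta; rewrite add_lfunE add_lfunE nE comp_lfunE gammaE [delta F]linfunE //.
rewrite DE -linearD; congr ((F : 'Hom(_, _)) _).
rewrite -[X in X + _]scale1r -end_starP //; last first.
  apply: hom_comp; [exact: through_hom tg | exact: hom_end_coord].
congr end_star; rewrite scale1r comp_lfunDl; congr (_ + _).
rewrite -comp_lfunA; congr (b \o _)%VF; apply/lfunP=> x; apply/lfunP=> c.
rewrite coind_mapE pointE comp_lfunE hom_end_coord ha act_coindE.
by rewrite mul1r.
Qed.

Hypothesis injH : self_injective H.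

Lemma nakayama_end_mod_in_add : in_add (eq end_mod) (nakayama end_mod).
Proof.
have [n tn nE] := nakayama_end_mod_through (self_injective_in_add injH).
rewrite /in_add; suff -> : \1%VF = n by [].
apply/lfunP=> F; apply/lfunP=> eta.
by rewrite id_lfunE nE comp_lfun1l end_coordK.
Qed.

Lemma end_mod_strongly_projinj : strongly_projinj end_mod.
Proof.
apply/strongly_projinjP=> i.
apply: (@projective_in_add _ _ (eq end_mod)) => [_ <-|].
  exact: end_mod_projective.
elim: i => [|i /in_add_nu_eq]; first exact: in_add_self.
by apply: in_add_trans => _ <-; apply: nakayama_end_mod_in_add.
Qed.

Lemma end_mod_injective : injective_mod end_mod.
Proof.
exact: strongly_projinj_injective end_mod_strongly_projinj
  nakayama_end_mod_in_add.
Qed.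

(* [End_H(G)] is the kernel of [f |-> (h |-> f h - h f)] on [End_k(G)].        *)
Lemma nu_domdim_ge2_of_End : nu_domdim_ge A 2.
Proof.
pose Q0 := power G end_mod; pose Q1 := power H Q0.
have add0 : in_add (eq end_mod) Q0 by apply: power_in_add.
have add1 : in_add (eq end_mod) Q1.
  by apply: in_add_trans (power_in_add H Q0) => _ <-.
have inj Q : in_add (eq end_mod) Q -> injective_mod Q.
  by apply: injective_in_add => _ <-; apply: end_mod_injective.
have sp Q : in_add (eq end_mod) Q -> strongly_projinj Q.
  by apply: strongly_projinj_in_add => _ <-; apply: end_mod_strongly_projinj.
pose v : 'Hom(regular A, Q0) := phi.
have hv : is_hom v.
  move=> a b; apply/lfunP=> x.
  by rewrite act_powerE /v act_end_modE -comp_lfunE -phiM.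
have wL1 (f : 'End(G)) : linear (fun h => hom_defect h f).
  move=> c h h'; apply/lfunP=> x.
  rewrite [RHS]add_lfunE scale_lfunE /hom_defect !add_lfunE !opp_lfunE !comp_lfunE.
  rewrite !act_endE actDl actZl linearP actDl actZl scalerBr opprD.
  by rewrite addrACA.
pose w : 'Hom(Q0, Q1) :=
  linfun (fun f : Q0 => linfun (fun h => hom_defect h (f : 'End(G)) : Q0) : Q1).
have wE f h : (w f : 'Hom(H, Q0)) h = hom_defect h (f : 'End(G)).
  rewrite linfunE ?linfunE // => c f1 f2; apply/lfunP=> h'.
  by rewrite add_lfunE scale_lfunE !(linfunE (wL1 _)) hom_defect_linear.
have hw : is_hom w.
  move=> a f; apply/lfunP=> h; rewrite act_powerE !wE; apply/lfunP=> x.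
  rewrite act_powerE /hom_defect !add_lfunE !opp_lfunE !comp_lfunE.
  by rewrite !act_endE !act_end_modE linearB /= phi_hom.
apply: (nu_domdim_ge2_of_copresentation (v := v) (w := w)) => //;
  try by [apply: inj | apply: sp].
rewrite /v phiG; apply/vspaceP=> f; rewrite memv_ker.
apply/homAP/eqP=> [hf|wf].
  apply/lfunP=> h; rewrite wE zero_lfunE; apply/lfunP=> x.
  rewrite add_lfunE opp_lfunE !comp_lfunE !act_endE zero_lfunE hf.
  by rewrite subrr.
move=> h x; have := wE f h; rewrite wf zero_lfunE => /esym/lfunP/(_ x).
rewrite add_lfunE opp_lfunE !comp_lfunE !act_endE zero_lfunE => /eqP.
by rewrite subr_eq0 => /eqP.
Qed.

End EndomorphismAlgebra.

Lemma nu_domdim_ge2_of_Morita (k : fieldType) (A : falgType k) :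
  Morita_algebra A -> nu_domdim_ge A 2.
Proof.
case=> H [M [injH [phi [phi0 phiG phi1 phiM]]]].
have [pi [hpi piE]] := dsum_hom (@hom_id _ _ (regular H))
  (@hom_zero _ _ M (regular H)).
apply: (nu_domdim_ge2_of_End (s := (1, 0) : dsum (regular H) M) hpi
  _ phi0 phiG phi1 phiM injH).
by rewrite piE id_lfunE linear0 addr0.
Qed.

(** * Fitting idempotents and maximal projective left ideals *)

(** By finite dimension some n^i is a combination of higher powers, n^i = n^(i+1) q with q commuting
    with n. Then f = n^(i+1) q^(i+1) satisfies n^(i+1) f = n^(i+1), so it is idempotent, and it
    vanishes only if n^(i+1) does. *)
Lemma idempotent_or_nilpotent (k : fieldType) (A : falgType k) (n : A) :
  (exists m, n ^+ m = 0) \/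
  exists g f : A, [/\ f = n * g, f = g * n, f * f = f & f != 0].
Proof.
pose X := [tuple n ^+ i | i < (\dim {:A}).+1].
have /[!freeNE]/existsP[i] : ~~ free X.
  apply/negP; rewrite /free size_tuple => /eqP dX.
  by have := dimvS (subvf <<X>>); rewrite dX ltnn.
have nth_X (j : nat) : (j < (\dim {:A}).+1)%N -> X`_j = n ^+ j.
  by move=> jd; rewrite -(tnth_nth 0 X (Ordinal jd)) tnth_mktuple.
rewrite nth_X //.
have /subvP sub : (<<drop i.+1 X>> <= amull (n ^+ i.+1) @: 'C[n])%VS.
  apply/span_subvP=> x /(nthP 0)[j]; rewrite size_drop size_tuple => jd <-.
  rewrite nth_drop nth_X -?ltn_subRL //.
  have -> : n ^+ (i.+1 + j) = amull (n ^+ i.+1) (n ^+ j) by rewrite lfunE exprD.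
  by apply: memv_img; apply/cent1vP; rewrite -exprS -exprSr.
move/sub/memv_imgP=> [q /cent1vP qn]; rewrite lfunE /= => nq.
have cq (a b : nat) : q ^+ a * n ^+ b = n ^+ b * q ^+ a.
  exact/esym/(commrX a (commr_sym (commrX b qn))).
have nq1 m : n ^+ (i.+1 + m) = n ^+ (i.+1 + m.+1) * q.
  have -> : (i.+1 + m = m.+1 + i)%N by rewrite addSnnS addnC.
  by rewrite exprD {1}nq mulrA -exprD addnC.
have step m : n ^+ i.+1 = n ^+ (i.+1 + m) * q ^+ m.
  elim: m => [|m IH]; first by rewrite addn0 mulr1.
  by rewrite {1}IH nq1 -mulrA -exprS.
have nf : n ^+ i.+1 * (n ^+ i.+1 * q ^+ i.+1) = n ^+ i.+1.
  by rewrite mulrA -exprD -step.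
have [f0 | f0] := boolP (n ^+ i.+1 * q ^+ i.+1 == 0).
  by left; exists i.+1; rewrite -nf (eqP f0) mulr0.
right; exists (n ^+ i * q ^+ i.+1), (n ^+ i.+1 * q ^+ i.+1); split=> //.
- by rewrite exprS mulrA.
- by rewrite -mulrA -{3}(expr1 n) cq mulrA -exprD addn1.
by rewrite mulrA -(mulrA _ (q ^+ _) (n ^+ _)) cq nf.
Qed.

Section ProjectiveIdeals.
Variables (k : fieldType) (A : falgType k).
Implicit Types (e f : A) (M N X : amod A).

Definition left_ideal e : {vspace regular A} := lker (amulr e - \1)%VF.

Lemma mem_left_ideal e x : (x \in left_ideal e) = (x * e == x).
Proof. by rewrite memv_ker add_lfunE opp_lfunE id_lfunE lfunE subr_eq0. Qed.

Lemma left_ideal_submodule e : submodule (left_ideal e).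
Proof.
move=> a v; rewrite !mem_left_ideal => /eqP ve.
by rewrite /= -mulrA ve.
Qed.

(* The left ideal A e when [e] is idempotent. *)
Definition ideal_mod e : amod A := submod (@left_ideal_submodule e).
Definition ideal_incl e : 'Hom(ideal_mod e, regular A) :=
  sub_incl (@left_ideal_submodule e).

Lemma hom_ideal_incl e : is_hom (ideal_incl e).
Proof. exact: hom_sub_incl. Qed.

Lemma ideal_incl_inj e : injective (ideal_incl e).
Proof. exact/lker0_inj/lker_sub_incl. Qed.

Lemma ideal_inclK e (x : ideal_mod e) : ideal_incl e x * e = ideal_incl e x.
Proof. by apply/eqP; rewrite -mem_left_ideal sub_inclE subvsP. Qed.

Lemma to_ideal e N (f : 'Hom(N, regular A)) :
  is_hom f -> (forall x, f x * e = f x) ->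
  exists g : 'Hom(N, ideal_mod e),
    is_hom g /\ forall x, ideal_incl e (g x) = f x.
Proof.
move=> hf fe; apply: sub_corestr => // x.
by rewrite mem_left_ideal fe.
Qed.

Definition projinj_nu X := strongly_projinj X /\ injective_mod X.

Lemma projinj_nu_in_add (C : amod A -> Prop) X :
  (forall Y, C Y -> projinj_nu Y) -> in_add C X -> projinj_nu X.
Proof.
move=> CP addX; split.
  by apply: strongly_projinj_in_add addX => Y /CP[].
by apply: injective_in_add addX => Y /CP[].
Qed.

Lemma nakayama_projinj_nu X : projinj_nu X -> projinj_nu (nakayama X).
Proof.
case=> spX _; split; first exact: strongly_projinj_nu.
by apply: nakayama_injective; case: spX.
Qed.

Lemma ideal_mod0 : projinj_nu (ideal_mod 0).
Proof.
apply: (@projinj_nu_in_add (fun _ => False)) => //; rewrite /in_add.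
suff -> : \1%VF = 0 :> 'Hom(ideal_mod 0, ideal_mod 0) by apply: through0.
apply/lfunP=> x; apply: ideal_incl_inj.
by rewrite id_lfunE zero_lfunE linear0 -ideal_inclK mulr0.
Qed.

(** On A(e + f) one has x = x e + x f, and the right multiplications by e and f factor through Ae
    and Af. *)
Lemma ideal_modD e f : e * e = e -> f * f = f -> e * f = 0 -> f * e = 0 ->
  projinj_nu (ideal_mod e) -> projinj_nu (ideal_mod f) ->
  projinj_nu (ideal_mod (e + f)).
Proof.
move=> ee ff ef fe Pe Pf.
have mulr g := @hom_act_vec _ _ (regular A) g.
pose h := e + f.
have comp g : g * g = g -> g * h = g ->
    exists u : 'Hom(ideal_mod h, ideal_mod h),
      (projinj_nu (ideal_mod g) -> through projinj_nu u) /\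
      forall x, ideal_incl h (u x) = ideal_incl h x * g.
  move=> gg gh.
  have [|b [hb bE]] := to_ideal (e := g)
    (hom_comp (mulr g) (@hom_ideal_incl h)).
    by move=> x; rewrite comp_lfunE act_vecE /= -mulrA gg.
  have [|a [ha aE]] := to_ideal (e := h) (@hom_ideal_incl g).
    by move=> x; rewrite -ideal_inclK -mulrA gh.
  exists (a \o b)%VF; split=> [Pg|x]; first exact: through1.
  by rewrite comp_lfunE aE bE comp_lfunE act_vecE.
have [|u [/(_ Pe) tu uE]] := comp e ee; first by rewrite mulrDr ee ef addr0.
have [|v [/(_ Pf) tv vE]] := comp f ff; first by rewrite mulrDr ff fe add0r.
apply: (@projinj_nu_in_add projinj_nu) => //; rewrite /in_add.
suff -> : \1%VF = u + v by apply: throughD.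
apply/lfunP=> x; apply: ideal_incl_inj; rewrite id_lfunE add_lfunE linearD /=.
by rewrite uE vE -mulrDr ideal_inclK.
Qed.

(* Take [Z] maximal among the proper submodules of [X] containing [A e X].  In *)
(* the simple module [X / Z] some [c != 0] has [c = eta(y) c = n c], where    *)
(* [n = (1 - e) eta(y) (1 - e)]; so [n] is not nilpotent.                      *)
Lemma orthogonal_idempotent_exists X e : projective_mod X -> e * e = e ->
  ~ (trace X <= trace (ideal_mod e))%VS ->
  exists f, [/\ f * f = f, f != 0, e * f = 0, f * e = 0
    & in_add (eq X) (ideal_mod f)].
Proof.
case/dual_basis=> r [s [eta [heta sE]]] ee ntrace.
pose b i : X := (vbasis {:X})`_i.
pose Y : {vspace X} :=
  (\sum_(i < \dim {:X}) limg (act_vec (act X e (b i))))%VS.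
have YE a x : act X a (act X e x) \in Y.
  rewrite -(coord_sum x) act_sumr act_sumr; apply: memv_suml => i _.
  rewrite !actZr memvZ // -act_vecE; apply: (subvP (sumv_sup i _ (subvv _))) => //.
  by rewrite memv_img ?memvf.
have Yproper : Y <> fullv.
  move=> Yf; apply: ntrace; apply/subv_sumP=> i _.
  apply/subvP=> _ /memv_imgP[x _ ->]; set th : 'Hom(X, regular A) := _`_i.
  have hth : is_hom th by apply/homAP; rewrite vbasis_mem // memt_nth.
  have /memv_sumP[y yE ->] : x \in Y by rewrite Yf memvf.
  rewrite linear_sum /=; apply: memv_suml => j _.
  have /memv_imgP[a _ ->] := yE j isT; rewrite act_vecE -actM hth /=.
  pose w : ideal_mod e := vsproj _ (a * e : regular A).
  have wE : ideal_incl e w = a * e.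
    by rewrite sub_inclE vsprojK // mem_left_ideal -mulrA ee.
  have := mem_trace w (hom_comp (@hom_act_vec _ _ (regular A) (th (b j)))
    (@hom_ideal_incl e)).
  by rewrite comp_lfunE act_vecE wE.
pose good (Z : {vspace X}) := [/\ submodule Z, (Y <= Z)%VS & Z != fullv].
have [||d [[Z [[hZ YZ Zf] dZ]] dmax]] :=
    @exists_max_nat (fun d => exists Z, good Z /\ d = \dim Z) (\dim {:X}).
- exists (\dim Y), Y; split=> //; split=> //; last exact/eqP.
  move=> a _ /memv_sumP[y yE ->]; rewrite act_sumr; apply: memv_suml => i _.
  have /memv_imgP[c _ ->] := yE i isT.
  by rewrite act_vecE -actM YE.
- by move=> _ [Z [_ ->]]; apply/dimvS/subvf.
have eZ x : act X e x \in Z by rewrite -[act X e x]act1 (subvP YZ).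
have [i [x xZ]] : exists i x, act X (eta i x) (s i) \notin Z.
  apply: Classical_Prop.NNPP => none; case/eqP: Zf; apply/eqP.
  rewrite eqEsubv subvf; apply/subvP=> x _.
  rewrite (sE x); apply: memv_suml => i _; apply/negPn/negP=> nZ.
  by apply: none; exists i, x.
pose c := s i; have cZ : c \notin Z by apply: contraNN xZ; apply: hZ.
have hV := limg_submodule (hom_comp (@hom_act_vec _ _ _ c) (heta i)).
set V := limg _ in hV.
have ZV : (Z + V)%VS = fullv.
  apply/eqP; apply: contraNT xZ => ZVf.
  have Vc : act X (eta i x) (s i) \in V.
    by apply/memv_imgP; exists x; rewrite ?memvf // comp_lfunE act_vecE.
  have : (\dim (Z + V) <= \dim Z)%N.
    rewrite -dZ; apply: dmax; exists (Z + V)%VS; split=> //; split=> //.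
      exact: add_submodule.
    exact: subv_trans YZ (addvSl _ _).
  rewrite (geq_leqif (dimv_leqif_sup (addvSl Z V))) subv_add => /andP[_ VZ].
  exact: (subvP VZ).
have /memv_addP[z zZ [_ /memv_imgP[y _ ->] cE]] : c \in (Z + V)%VS.
  by rewrite ZV memvf.
pose e' := 1 - e; pose n := e' * eta i y * e'.
have ee' : e * e' = 0 by rewrite mulrBr mulr1 ee subrr.
have e'e : e' * e = 0 by rewrite mulrBl mul1r ee subrr.
have e'Z u : u - act X e' u \in Z by rewrite actBl act1 opprB addrC subrK.
have nZ : c - act X n c \in Z.
  have c1 : c - act X (eta i y) c \in Z.
    by rewrite {1}cE comp_lfunE act_vecE addrK.
  have c2 : act X (eta i y) c - act X (eta i y) (act X e' c) \in Z.
    by rewrite -actBr hZ.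
  have := memvD (memvD c1 c2) (e'Z (act X (eta i y) (act X e' c))).
  by rewrite !subrKA -!actM.
have nmZ m : c - act X (n ^+ m) c \in Z.
  elim: m => [|m IH]; first by rewrite expr0 act1 subrr mem0v.
  have := memvD nZ (hZ n _ IH).
  by rewrite actBr subrKA -actM -exprS.
have [[m nm]|[g [f [fng fgn ff f0]]]] := idempotent_or_nilpotent n.
  by move: (nmZ m); rewrite nm act0l subr0 (negPf cZ).
exists f; split=> //.
- by rewrite fng !mulrA ee' !mul0r.
- by rewrite fgn -!mulrA e'e !mulr0.
(* With e' = 1 - e, the maps are u |-> u e' y and x |-> eta(x) e' g f; the composite sends u to u e'
   eta(y) e' g f = u n g f = u f f = u. *)
pose al : 'Hom(ideal_mod f, X) := (act_vec (act X e' y) \o ideal_incl f)%VF.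
have hal : is_hom al := hom_comp (@hom_act_vec _ _ X _) (@hom_ideal_incl f).
have [|be [hbe beE]] := to_ideal (e := f)
  (hom_comp (@hom_act_vec _ _ (regular A) (e' * g * f)) (heta i)).
  by move=> u; rewrite comp_lfunE act_vecE /= -!mulrA ff.
apply: (in_add_retract hal hbe) => u; apply: ideal_incl_inj.
rewrite beE !comp_lfunE !act_vecE -actM heta /=.
rewrite -[RHS]ideal_inclK -[in RHS]ideal_inclK -[in RHS]mulrA.
have -> : f * f = n * g * f by rewrite -fng.
by rewrite /n !mulrA.
Qed.

(** Choose e with dim Ae maximal. If X were outside add(Ae), its trace would not lie in that of Ae,
    and the resulting f orthogonal to e would make A(e + f) a strictly larger candidate. *)
Lemma maximal_projinj_idempotent :
  exists e, [/\ e * e = e, projinj_nu (ideal_mod e)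
    & forall X, projinj_nu X -> in_add (eq (ideal_mod e)) X].
Proof.
pose P (d : nat) := exists e,
  [/\ e * e = e, projinj_nu (ideal_mod e) & d = \dim (left_ideal e)].
have [||_ [[e [ee Pe ->]] emax]] := @exists_max_nat P (\dim {:regular A}).
- by exists (\dim (left_ideal 0)), 0; split; [rewrite mul0r|apply: ideal_mod0|].
- by move=> _ [e [_ _ ->]]; apply/dimvS/subvf.
exists e; split=> // X PX; apply: in_add_trace; first by case: PX => -[].
apply/negPn/negP=> /negP ntrace.
have projX : projective_mod X by case: PX => -[].
have [f [ff f0 ef fe addf]] := orthogonal_idempotent_exists projX ee ntrace.
have Pf : projinj_nu (ideal_mod f).
  by apply: projinj_nu_in_add addf => _ <-.
have : P (\dim (left_ideal (e + f)%R)).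
  exists (e + f); split=> //; last exact: ideal_modD.
  by rewrite mulrDl !mulrDr ee ff ef fe addr0 add0r.
move/emax; have sub : (left_ideal e <= left_ideal (e + f)%R)%VS.
  apply/subvP=> x; rewrite !mem_left_ideal => /eqP xe.
  by rewrite mulrDr -{2}xe -mulrA ef mulr0 addr0 xe.
rewrite (geq_leqif (dimv_leqif_sup sub)) => /subvP/(_ f).
rewrite !mem_left_ideal mulrDr fe add0r ff eqxx => /(_ isT).
by rewrite eq_sym (negPf f0).
Qed.

End ProjectiveIdeals.

(** * The double centralizer property *)

Section DoubleCentralizer.
Variables (k : fieldType) (A : falgType k).
Implicit Types (M N I X : amod A).

Lemma in_add_separated X I (z : I) : in_add (eq X) I ->
  (forall th : 'Hom(I, X), is_hom th -> th z = 0) -> z = 0.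
Proof.
move=> addI thz; rewrite -[z]id_lfunE.
elim: addI => [|Y b a f eY hb ha _ IH]; first by rewrite zero_lfunE.
case: _ / eY => {Y} in a b ha hb *.
by rewrite add_lfunE comp_lfunE thz // linear0 IH addr0.
Qed.

(** If the identity of I is a sum of composites a b through X, take g to be the sum of the a f b; f
    commutes with each endomorphism th a of X. *)
Lemma extend_centralizing X I (f : 'End(X)) :
  (forall th : 'Hom(X, X), is_hom th -> forall x, f (th x) = th (f x)) ->
  in_add (eq X) I ->
  exists g : 'End(I), forall th : 'Hom(I, X), is_hom th ->
    forall z, th (g z) = f (th z).
Proof.
move=> fc addI.
suff main (t : 'Hom(I, I)) : through (eq X) t ->
    exists g : 'End(I), forall th : 'Hom(I, X), is_hom th ->
    forall z, th (g z) = f (th (t z)).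
  have [g gE] := main _ addI; exists g => th hth z.
  by rewrite gE // id_lfunE.
elim=> [|Y b a h eY hb ha _ [g gE]].
  by exists 0 => th _ z; rewrite !zero_lfunE !linear0.
case: _ / eY => {Y} in a b ha hb *.
exists ((a \o f \o b)%VF + g) => th hth z.
rewrite !add_lfunE !linearD /= gE //; congr (_ + _).
have := fc _ (hom_comp hth ha) (b z).
by rewrite !comp_lfunE => ->.
Qed.

Section Copresentation.
Variables (X I0 I1 : amod A) (eps : 'Hom(regular A, I0)) (d : 'Hom(I0, I1)).
Hypotheses (injX : injective_mod X).
Hypotheses (add0 : in_add (eq X) I0) (add1 : in_add (eq X) I1).
Hypotheses (heps : is_hom eps) (hd : is_hom d).
Hypotheses (keps : lker eps = 0%VS) (eps_d : limg eps = lker d).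

Lemma double_centralizer (f : 'End(X)) :
  (forall th : 'Hom(X, X), is_hom th -> forall x, f (th x) = th (f x)) ->
  exists a, forall x, f x = act X a x.
Proof.
move=> fc; have [g gE] := extend_centralizing fc add0.
(* Maps th : I1 -> X separate points, and th(d(g(eps 1))) = f(th(d(eps 1))) = 0; so g(eps 1) lies in
   ker d = im eps, which provides a. *)
have /memv_imgP[a _ aE] : g (eps 1) \in limg eps.
  rewrite eps_d memv_ker; apply/eqP; apply: (in_add_separated add1) => th hth.
  rewrite -comp_lfunE gE; last exact: hom_comp.
  rewrite comp_lfunE.
  have : eps 1 \in lker d by rewrite -eps_d memv_img ?memvf.
  by rewrite memv_ker => /eqP->; rewrite !linear0.
exists a => x.
(* The map A -> X with 1 |-> x extends to u on I0, and f(x) = f(u(eps 1)) = u(g(eps 1)) = u(eps a) =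
   a x. *)
have [|u [hu uE]] := injective_extend injX heps (@hom_act_vec _ _ _ x).
  by rewrite keps sub0v.
by have := gE u hu (eps 1); rewrite aE !uE !act_vecE act1.
Qed.

Lemma faithful_of_copresentation a : (forall x, act X a x = 0) -> a = 0.
Proof.
move=> aX; apply: (lker0_inj keps); rewrite linear0.
apply: (in_add_separated add0) => th hth.
have -> : a = act (regular A) a 1 by rewrite /= mulr1.
by rewrite heps hth aX.
Qed.

End Copresentation.
End DoubleCentralizer.

(** * The algebra (eAe)^op *)

Section OppositeCorner.
Variables (k : fieldType) (A : falgType k) (e : A).

Definition corner : {vspace A} :=
  (lker (amull e - \1) :&: lker (amulr e - \1))%VF%VS.

Lemma mem_corner x : (x \in corner) = (e * x == x) && (x * e == x).
Proof.
by rewrite memv_cap !memv_ker !add_lfunE !opp_lfunE !id_lfunE !lfunE !subr_eq0.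
Qed.

Lemma corner_l (x : subvs_of corner) : e * vsval x = vsval x.
Proof. by have := subvsP x; rewrite mem_corner => /andP[/eqP]. Qed.

Lemma corner_r (x : subvs_of corner) : vsval x * e = vsval x.
Proof. by have := subvsP x; rewrite mem_corner => /andP[_ /eqP]. Qed.

(* (e A e)^op; the proofs are parameters so that the instances below can be    *)
(* found from the type alone.                                                  *)
Definition opcorner (ee : e * e = e) (e0 : e != 0) := subvs_of corner.

Variables (ee : e * e = e) (e0 : e != 0).
Notation H := (opcorner ee e0).

HB.instance Definition _ := Vector.on H.

Let mul (x y : H) : H := vsproj corner (vsval y * vsval x).
Let one : H := vsproj corner e.

Fact opcorner_mulE x y : vsval (mul x y) = vsval y * vsval x.
Proof. by rewrite vsprojK // mem_corner mulrA corner_l -mulrA corner_r !eqxx. Qed.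
Fact opcorner_oneE : vsval one = e.
Proof. by rewrite vsprojK // mem_corner ee eqxx. Qed.

Fact opcorner_mulA : associative mul.
Proof. by move=> x y z; apply/val_inj; rewrite /= !opcorner_mulE mulrA. Qed.
Fact opcorner_mul1 : left_id one mul.
Proof.
by move=> x; apply/val_inj; rewrite /= opcorner_mulE opcorner_oneE corner_r.
Qed.
Fact opcorner_mulr1 : right_id one mul.
Proof.
by move=> x; apply/val_inj; rewrite /= opcorner_mulE opcorner_oneE corner_l.
Qed.
Fact opcorner_mulDl : left_distributive mul +%R.
Proof. by move=> x y z; apply/val_inj; rewrite /= !opcorner_mulE mulrDr. Qed.
Fact opcorner_mulDr : right_distributive mul +%R.
Proof. by move=> x y z; apply/val_inj; rewrite /= !opcorner_mulE mulrDl. Qed.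
Fact opcorner_neq0 : one != 0.
Proof.
by apply: contraNneq e0 => /(congr1 vsval); rewrite opcorner_oneE => ->.
Qed.

HB.instance Definition _ := GRing.Zmodule_isNzRing.Build H
  opcorner_mulA opcorner_mul1 opcorner_mulr1 opcorner_mulDl opcorner_mulDr
  opcorner_neq0.

Fact opcorner_scaleAl (c : k) (x y : H) : c *: (x * y) = (c *: x) * y.
Proof.
by apply/val_inj; rewrite /= !opcorner_mulE /= scalerAr.
Qed.
HB.instance Definition _ := GRing.Lmodule_isLalgebra.Build k H opcorner_scaleAl.
Fact opcorner_scaleAr (c : k) (x y : H) : c *: (x * y) = x * (c *: y).
Proof.
by apply/val_inj; rewrite /= !opcorner_mulE /= scalerAl.
Qed.
HB.instance Definition _ := GRing.Lalgebra_isAlgebra.Build k H opcorner_scaleAr.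
HB.instance Definition _ := Algebra_isFalgebra.Build k H.

Lemma val_opcornerM (x y : H) : vsval (x * y) = vsval y * vsval x.
Proof. exact: opcorner_mulE. Qed.

Lemma val_opcorner1 : vsval (1 : H) = e.
Proof. exact: opcorner_oneE. Qed.

End OppositeCorner.

(** * Self-injectivity of the corner algebra *)

Section CornerSelfInjective.
Variables (k : fieldType) (A : falgType k) (e : A).
Variables (ee : e * e = e) (e0 : e != 0).
Notation H := (opcorner ee e0).
Notation X := (ideal_mod e).
Notation starX := (subvs_of (homA X (regular A))).

Let to_H (x : A) : H := vsproj (corner e) x.
Let to_HK x : e * x = x -> x * e = x -> vsval (to_H x) = x.
Proof. by move=> ex xe; rewrite vsprojK // mem_corner ex xe eqxx. Qed.
Let to_HP c x y : to_H (c *: x + y) = c *: to_H x + to_H y.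
Proof. exact: linearP. Qed.

Let eX : X := vsproj (left_ideal e) (e : regular A).
Let eXE : ideal_incl e eX = e.
Proof. by rewrite sub_inclE vsprojK // mem_left_ideal ee. Qed.
Let XE (x : X) : x = act X (ideal_incl e x) eX.
Proof. by apply: ideal_incl_inj; rewrite hom_ideal_incl eXE /= ideal_inclK. Qed.

Lemma form_corner (eta : starX) a : e * a = a -> a * e = a ->
  e * (vsval eta eX * a) = vsval eta eX * a /\
  vsval eta eX * a * e = vsval eta eX * a.
Proof.
move=> ea ae; split; last by rewrite -mulrA ae.
rewrite mulrA; congr (_ * _); rewrite -[LHS](star_hom eta e eX).
by congr (vsval eta _); apply: ideal_incl_inj; rewrite hom_ideal_incl eXE /= ee.
Qed.

Let lift_linear (F : 'Hom(H, k^o)) :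
  linear (fun eta : starX => F (to_H (vsval eta eX * e))).
Proof.
move=> c u v; rewrite linearP add_lfunE scale_lfunE mulrDl.
have -> : (c *: vsval u eX) * e = c *: (vsval u eX * e) by rewrite -scalerAl.
by rewrite to_HP linearP.
Qed.

(** Under Hom_A(Ae, A) = eA, eta |-> eta(e), a form on eAe is extended by zero on eA(1 - e). This
    realises D(eAe) inside nu(Ae) = D(eA). *)
Definition lift_form (F : 'Hom(H, k^o)) : nakayama X :=
  linfun (fun eta : starX => F (to_H (vsval eta eX * e))).

Lemma lift_formE F (eta : starX) :
  (lift_form F : 'Hom(starX, k^o)) eta = F (to_H (vsval eta eX * e)).
Proof. by rewrite linfunE. Qed.

Lemma lift_form_linear : linear lift_form.
Proof.
move=> c F F'; apply/lfunP=> eta.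
by rewrite add_lfunE scale_lfunE !lift_formE add_lfunE scale_lfunE.
Qed.

Lemma act_lift_form (r : H) F :
  act (nakayama X) (vsval r) (lift_form F) = lift_form (F \o amull r)%VF.
Proof.
apply/lfunP=> eta; rewrite act_nakayamaE !lift_formE comp_lfunE lfunE /=.
congr (F _); apply: val_inj.
have [l1 r1] := form_corner eta ee ee.
have [l2 r2] := form_corner eta (corner_l r) (corner_r r).
have -> : vsval (hom_mulr (vsval r) eta) eX = vsval eta eX * vsval r.
  exact: hom_mulrE.
rewrite [LHS]to_HK ?r2 //.
by rewrite [RHS]val_opcornerM to_HK // -mulrA corner_l.
Qed.

Lemma lift_form_corner (b : 'Hom(nakayama X, X)) F : is_hom b ->
  vsval (to_H (ideal_incl e (b (lift_form F)))) = ideal_incl e (b (lift_form F)).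
Proof.
move=> hb; apply: to_HK; last exact: ideal_inclK.
have elift : act (nakayama X) e (lift_form F) = lift_form F.
  have := act_lift_form 1 F; rewrite val_opcorner1 => ->.
  by congr lift_form; apply/lfunP=> x; rewrite comp_lfunE lfunE /= mul1r.
apply: etrans (esym (@hom_ideal_incl _ _ e e (b _))) _.
by rewrite -hb elift.
Qed.

Definition mul_form (y : A) : starX :=
  vsproj (homA X (regular A)) (act_vec (y : regular A) \o ideal_incl e)%VF.

Lemma mul_formE y x : vsval (mul_form y) x = ideal_incl e x * y.
Proof.
rewrite vsprojK ?comp_lfunE ?act_vecE //; apply/homAP.
exact: hom_comp (@hom_act_vec _ _ (regular A) y) (@hom_ideal_incl _ _ e).
Qed.

Lemma mul_formP c x y : mul_form (c *: x + y) = c *: mul_form x + mul_form y.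
Proof.
apply/val_inj/lfunP=> z.
have -> : \val (mul_form (c *: x + y)) z = ideal_incl e z * (c *: x + y).
  exact: mul_formE.
rewrite linearP add_lfunE scale_lfunE !mul_formE mulrDr -scalerAr.
by [].
Qed.

(** Multiplication by e turns a factorisation of t through Ae into one of an endomorphism of D(eAe)
    through eAe. Dualising gives n, the transpose of that endomorphism, which factors through DH. *)
Lemma corner_through (t : 'Hom(nakayama X, nakayama X)) :
  through (eq X) t ->
  exists2 n : 'Hom(regular H, regular H), through (eq (coind H k^o)) n &
    forall (F : 'Hom(H, k^o)) (y : H),
      F (n y) = (t (lift_form F) : 'Hom(starX, k^o)) (mul_form (vsval y)).
Proof.
elim=> [|Y b a h eY hb ha _ [n tn nE]].
  by exists 0 => [|F y]; [exact: through0 | rewrite !zero_lfunE linear0].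
case: _ / eY => {Y} in a b ha hb *.
have kL : linear (fun y : H =>
    (a eX : 'Hom(starX, k^o)) (mul_form (vsval y))).
  by move=> c u v; rewrite linearP mul_formP linearP.
(* As e generates Ae, the map a is recorded by the form a(e) on eA; its restriction to eAe induces H
   -> DH. *)
pose kappa : 'Hom(H, k^o) := linfun (fun y : H =>
    (a eX : 'Hom(starX, k^o)) (mul_form (vsval y))).
pose z F := to_H (ideal_incl e (b (lift_form F))).
have zE F : vsval (z F) = ideal_incl e (b (lift_form F)).
  exact: lift_form_corner.
have zL (c : 'Hom(H, k^o)) : linear (fun F => c (z F)).
  by move=> l u v; rewrite /z lift_form_linear !linearP /= to_HP linearP.
(* P : DH -> DDH = H is the transpose of [z] : DH -> H, the restriction of b. *)
pose P (c : coind H k^o) : regular H :=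
  eval_point (linfun (fun F => (c : 'Hom(H, k^o)) (z F))).
have PE c (F : 'Hom(H, k^o)) : F (P c) = (c : 'Hom(H, k^o)) (z F).
  by rewrite eval_pointE linfunE.
have PL : linear P.
  move=> l u v; apply: form_sep => F.
  by rewrite linearP /= !PE add_lfunE scale_lfunE.
have hP : is_hom (linfun P : 'Hom(coind H k^o, regular H)).
  move=> r c; rewrite !linfunE //; apply: form_sep => F.
  rewrite PE act_coindE.
  have -> : F (act (regular H) r (P c)) = (F \o amull r)%VF (P c).
    by rewrite comp_lfunE lfunE.
  rewrite PE; congr (c _); apply: val_inj.
  rewrite [LHS]val_opcornerM zE; apply: etrans _ (esym (zE _)).
  by rewrite -act_lift_form hb hom_ideal_incl.
exists ((linfun P \o coind_map (kappa : 'Hom(regular H, k^o)))%VF + n).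
  by apply: through_add => //; apply: hom_coind_map.
move=> F y; rewrite !add_lfunE linearD; congr (_ + _); last exact: nE.
rewrite !comp_lfunE linfunE //; apply: etrans (PE _ F) _.
rewrite coind_mapE linfunE //.
rewrite [in RHS](XE (b _)) -zE ha act_nakayamaE.
congr ((a eX : 'Hom(_, _)) _); apply/val_inj/lfunP=> x.
have -> : \val (mul_form (vsval (act (regular H) (z F) y))) x =
    ideal_incl e x * vsval (z F * y) by exact: mul_formE.
rewrite val_opcornerM mulrA.
by apply: etrans (esym (hom_mulrE _ _ _)); rewrite mul_formE.
Qed.

Lemma opcorner_self_injective :
  in_add (eq X) (nakayama X) -> self_injective H.
Proof.
move/corner_through=> [n tn nE].
apply: (@injective_in_add _ _ (eq (coind H k^o))) => [_ <-|].
  exact: coind_injective.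
rewrite /in_add; suff -> : \1%VF = n by [].
apply/lfunP=> y; apply: form_sep => F; rewrite nE !id_lfunE lift_formE.
congr (F _); apply: val_inj; rewrite mul_formE eXE corner_l corner_r.
by rewrite [RHS]to_HK ?corner_l ?corner_r.
Qed.

End CornerSelfInjective.

(** * A as the endomorphism algebra of Ae over the corner *)

Section CornerDecomposition.
Variables (k : fieldType) (A : falgType k) (e : A).
Variables (ee : e * e = e) (e0 : e != 0).
Notation H := (opcorner ee e0).
Notation X := (ideal_mod e).

(* (1 - e) A e *)
Let W : {vspace A} := (lker (amull e) :&: lker (amulr e - \1))%VF%VS.

Let mem_W x : (x \in W) = (e * x == 0) && (x * e == x).
Proof.
by rewrite memv_cap !memv_ker !add_lfunE !opp_lfunE !id_lfunE !lfunE subr_eq0.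
Qed.

Let W_l (x : subvs_of W) : e * vsval x = 0.
Proof. by have := subvsP x; rewrite mem_W => /andP[/eqP]. Qed.

Let W_r (x : subvs_of W) : vsval x * e = vsval x.
Proof. by have := subvsP x; rewrite mem_W => /andP[_ /eqP]. Qed.

Let W_act (r : H) (x : subvs_of W) : subvs_of W := vsproj W (vsval x * vsval r).

Fact compl_actE r x : vsval (W_act r x) = vsval x * vsval r.
Proof. by rewrite vsprojK // mem_W mulrA W_l mul0r -mulrA corner_r !eqxx. Qed.
Fact compl_linear_l v : linear (fun a => W_act a v).
Proof.
move=> c a b; apply/val_inj.
by rewrite /= !compl_actE /= mulrDr -scalerAr.
Qed.
Fact compl_linear_r a : linear (W_act a).
Proof.
move=> c u v; apply/val_inj.
by rewrite /= !compl_actE /= mulrDl -scalerAl.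
Qed.
Fact compl_act1 v : W_act 1 v = v.
Proof. by apply/val_inj; rewrite /= compl_actE val_opcorner1 W_r. Qed.
Fact compl_actM a b v : W_act (a * b) v = W_act a (W_act b v).
Proof. by apply/val_inj; rewrite /= !compl_actE val_opcornerM mulrA. Qed.

Definition compl_mod : amod H :=
  AMod compl_linear_l compl_linear_r compl_act1 compl_actM.

Notation G := (dsum (regular H) compl_mod).

(** With [of_A], this identifies G with Ae = eAe + (1 - e)Ae as H-modules, r in H acting on Ae by
    right multiplication. *)
Let to_A (g : G) : A := vsval (g.1 : H) + vsval (g.2 : subvs_of W).
Let of_A (x : A) : G :=
  (vsproj (corner e) (e * x) : H, vsproj W (x - e * x)).

Let to_AP c u v : to_A (c *: u + v) = c *: to_A u + to_A v.
Proof. by rewrite /to_A /= scalerDr addrACA. Qed.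

Let of_AP c u v : of_A (c *: u + v) = c *: of_A u + of_A v.
Proof.
rewrite /of_A mulrDr -scalerAr linearP opprD addrACA -scalerN -scalerDr linearP.
by [].
Qed.

Let to_A_e g : to_A g * e = to_A g.
Proof. by rewrite mulrDl corner_r W_r. Qed.

Let of_AK x : x * e = x -> to_A (of_A x) = x.
Proof.
move=> xe; rewrite /to_A /= !vsprojK ?subrKC //.
  by rewrite mem_W mulrBr mulrBl !mulrA ee subrr -mulrA xe !eqxx.
by rewrite mem_corner mulrA ee -mulrA xe !eqxx.
Qed.

Let to_A_inj g h : to_A g = to_A h -> g = h.
Proof.
case: g h => [g1 g2] [h1 h2]; rewrite /to_A /= => gh.
have gh1 : g1 = h1.
  apply: val_inj => /=; have := congr1 ( *%R e) gh.
  by rewrite !mulrDr !corner_l !W_l !addr0.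
by congr pair => //; apply: val_inj; move: gh; rewrite gh1 => /addrI.
Qed.

Let to_A_act (r : H) g : to_A (act G r g) = to_A g * vsval r.
Proof.
rewrite /to_A mulrDl; congr (_ + _); last exact: compl_actE.
exact: val_opcornerM.
Qed.

Let to_A0 : to_A 0 = 0. Proof. by rewrite /to_A !linear0 addr0. Qed.

Hypothesis faithful : forall a, (forall x, act X a x = 0) -> a = 0.
Hypothesis centralizer : forall f : 'End(X),
  (forall th : 'Hom(X, X), is_hom th -> forall x, f (th x) = th (f x)) ->
  exists a, forall x, f x = act X a x.

Let incl_of x : x * e = x -> ideal_incl e (vsproj _ (x : regular A)) = x.
Proof. by move=> xe; rewrite sub_inclE vsprojK // mem_left_ideal xe. Qed.

Let mul_linear a : linear (fun g : G => of_A (a * to_A g)).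
Proof. by move=> c u v; rewrite to_AP mulrDr -scalerAr of_AP. Qed.

Let mulG a : 'End(G) := linfun (fun g : G => of_A (a * to_A g)).

Let mulGE a g : to_A (mulG a g) = a * to_A g.
Proof. by rewrite linfunE // of_AK // -mulrA to_A_e. Qed.

Let mulG_linear : linear mulG.
Proof.
move=> c a b; apply/lfunP=> g; apply: to_A_inj.
by rewrite add_lfunE scale_lfunE to_AP !mulGE mulrDl scalerAl.
Qed.

(** A acts on G = Ae by left multiplication, injectively by faithfulness. Endomorphisms of Ae over A
    are right multiplications by elements of eAe, so an H-linear map commutes with all of them and
    is left multiplication by some a. *)
Lemma isom_End_corner : isom_End A G.
Proof.
have phiE a g : to_A (linfun mulG a g) = a * to_A g.
  by rewrite (linfunE mulG_linear) mulGE.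
exists (linfun mulG); split.
- apply: inj_lker0 => a a0; apply: faithful => x; apply: ideal_incl_inj.
  rewrite hom_ideal_incl linear0.
  have := phiE a (of_A (ideal_incl e x)).
  by rewrite a0 zero_lfunE to_A0 of_AK // ideal_inclK.
- apply/vspaceP=> f; apply/memv_imgP/homAP=> [[a _ ->] r g|hf].
    by apply: to_A_inj; rewrite phiE !to_A_act phiE mulrA.
  pose f' := linfun (fun x : X =>
    vsproj _ (to_A (f (of_A (ideal_incl e x))) : regular A) : X).
  have f'E x : ideal_incl e (f' x) = to_A (f (of_A (ideal_incl e x))).
    rewrite [f' x]linfunE ?incl_of // => c u v.
    by rewrite linearP of_AP linearP to_AP linearP.
  have [th hth x|a fa] := centralizer (f := f').
    apply: ideal_incl_inj; rewrite f'E.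
    pose eX : X := vsproj _ (e : regular A).
    have thE z : ideal_incl e (th z) = ideal_incl e z * ideal_incl e (th eX).
      have {1}-> : z = act X (ideal_incl e z) eX.
        by apply: ideal_incl_inj; rewrite hom_ideal_incl incl_of //= ideal_inclK.
      by rewrite hth hom_ideal_incl.
    (* th is right multiplication by th(e), and th(e) = e th(e) lies in eAe. *)
    pose r : H := vsproj (corner e) (ideal_incl e (th eX)).
    have rE : vsval r = ideal_incl e (th eX).
      rewrite vsprojK // mem_corner ideal_inclK eqxx andbT.
      by rewrite [X in _ == X]thE incl_of.
    rewrite (thE x) (thE (f' x)) f'E -rE -to_A_act -hf; congr (to_A (f _)).
    by apply: to_A_inj; rewrite to_A_act !of_AK // -?mulrA ?corner_r ?ideal_inclK.
  exists a; first exact: memvf.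
  apply/lfunP=> g; apply: to_A_inj; rewrite phiE.
  have := f'E (vsproj _ (to_A g : regular A)).
  rewrite fa hom_ideal_incl incl_of // => aE; apply: etrans _ (esym aE).
  congr (to_A (f _)).
  by apply: to_A_inj; rewrite of_AK.
- by apply/lfunP=> g; apply: to_A_inj; rewrite phiE id_lfunE mul1r.
by move=> a b; apply/lfunP=> g; apply: to_A_inj; rewrite comp_lfunE !phiE mulrA.
Qed.

End CornerDecomposition.

(** * The two implications combined *)

Lemma Morita_of_nu_domdim_ge2 (k : fieldType) (A : falgType k) :
  nu_domdim_ge A 2 -> Morita_algebra A.
Proof.
case=> d [[J [eps [delta [[[Jinj [heps hdelta] keps eps_d _] _ _] dJ]]]] d2].
have sp : strongly_projinj_below J 2.
  case: d dJ d2 => [d [Jd _] d2 i i2|Jall _]; last exact: Jall.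
  by apply: Jd; apply: leq_trans i2 d2.
have [e [ee Pe emax]] := maximal_projinj_idempotent A.
have [spe inje] := Pe.
have addJ i : (i < 2)%N -> in_add (eq (ideal_mod e)) (J i).
  by move=> i2; apply: emax; split; [apply: sp | apply: Jinj].
have faithful := faithful_of_copresentation (addJ 0 isT) heps keps.
have central := double_centralizer inje (addJ 0 isT) (addJ 1 isT) heps
  (hdelta 0) keps eps_d.
have e0 : e != 0.
  (* If e = 0 then Ae = 0, and faithfulness would force 1 = 0 in A. *)
  apply/eqP=> eE; have /eqP := oner_neq0 A; apply; apply: faithful => x.
  apply: ideal_incl_inj.
  rewrite linear0 -ideal_inclK.
  exact: etrans (congr1 ( *%R _) eE) (mulr0 _).
exists (opcorner ee e0), (compl_mod ee e0); split.
  by apply: opcorner_self_injective; apply/emax/nakayama_projinj_nu.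
exact: isom_End_corner.
Qed.

Theorem proposition2p9 (k : fieldType) (A : falgType k) :
  nu_domdim_ge A 2 <-> Morita_algebra A.
Proof.
by split; [exact: Morita_of_nu_domdim_ge2 | exact: nu_domdim_ge2_of_Morita].
Qed.
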